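(* Let $\gamma>1$, $0<r_0<r_1$, and let an incoming flow at the outer circle $r=r_1$ be given by $\rho_0^->0$, $A_0^->0$, $U_{10}^-<0$, $U_{20}^-\ne0$ which is supersonic in the $r$-direction, i.e. $(U_{10}^-)^2>\gamma A_0^-(\rho_0^-)^{\gamma-1}$. Then there exist two positive constants $p_1<p_0$ such that, for an exit pressure $p_{ex}>0$ at $r=r_0$: if $f_2(\rho^{\sharp\sharp})>0$, or $f_2(\rho^{\sharp\sharp})\le0$ but $p_{ex}\notin(p_1,p_0)$, there does not exist any piecewise smooth solution to Problem IV in $\Omega$; if $f_2(\rho^{\sharp\sharp})\le0$ and $p_{ex}\in(p_1,p_0)$, there exists a unique piecewise smooth weak solution to Problem IV in $\Omega$ with a shock located at $r=r_b\in(r_0,r_1)$, with the following properties. (A) The shock position $r_b$ increases as the exit pressure $p_{ex}$ decreases. In addition, $r_b$ tends to $r_1$ if $p_{ex}$ goes to $p_1$ and $r_b$ approaches $r_0$ if $p_{ex}$ goes to $p_0$. (B) The flow patterns in $\Omega^+$ are classified as follows. 1. If $r_1>r_0\ge r'_*$, then 1.1. for $f_2(\rho^\sharp)<0$, it is a supersonic-subsonic shock and the flow is uniformly subsonic in $\Omega^+$; 1.2. for $f_2(\rho^\sharp)>0$, it is a supersonic-subsonic shock and the flow changes smoothly from subsonic to supersonic in $\Omega^+$; 1.3. for $f_2(\rho^\sharp)=0$, it is a supersonic-subsonic shock and the flow is subsonic in $\Omega^+$ but degenerates to a sonic state at the exit. 2. If $r_1>r'_*>r_0$, there exists $p'_*\in(p_1,p_0)$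 such that 2.1. for $p_{ex}\in(p_1,p'_* )$ with $f_2(\rho^\sharp)<0$, it is a supersonic-subsonic shock and the flow is uniformly subsonic in $\Omega^+$; 2.2. for $p_{ex}\in(p_1,p'_* )$ with $f_2(\rho^\sharp)>0$, it is a supersonic-subsonic shock and the flow changes smoothly from subsonic to supersonic in $\Omega^+$; 2.3. for $p_{ex}\in(p_1,p'_* )$ with $f_2(\rho^\sharp)=0$, it is a supersonic-subsonic shock and the flow is subsonic in $\Omega^+$ but degenerates to a sonic state at the exit; 2.4. for $p_{ex}\in(p'_*,p_0)$, there exists a supersonic-supersonic shock and the flow is uniformly supersonic in $\Omega^+$; 2.5. for $p_{ex}=p'_*$, there is a supersonic-sonic shock and the flow is supersonic in $\Omega^+$ but degenerates to the sonic state at the shock position. 3. If $r_1\le r'_*$, then for any $p_{ex}\in(p_1,p_0)$ there exists a supersonic-supersonic shock and the flow is uniformly supersonic in $\Omega^+$.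
   Context: Radially symmetric steady Euler system (for velocity $U_1(r)\mathbf e_r+U_2(r)\mathbf e_\theta$, density $\rho>0$, pressure $p=A\rho^\gamma$ with $A>0$): $$(E)\quad(\rho U_1)'+\tfrac1r\rho U_1=0,\quad U_1U_1'+\tfrac1\rho p'-\tfrac{U_2^2}{r}=0,\quad U_1U_2'+\tfrac{U_1U_2}{r}=0,\quad U_1A'=0.$$ Sound speed $c^2=\gamma p/\rho$; $M_1^2=U_1^2/c^2$; Bernoulli function $B=\frac12(U_1^2+U_2^2)+\frac{\gamma p}{(\gamma-1)\rho}$. The flow is supersonic, sonic, subsonic where $U_1^2+U_2^2>c^2$, $=c^2$, $<c^2$ respectively. Problem IV. On $\Omega=\{r_0<r<r_1\}$ find $r_b\in(r_0,r_1)$ and smooth functions $(U_1^\pm,U_2^\pm,\rho^\pm,p^\pm,A^\pm)$, where the ''$-$'' state is defined on $\Omega^-=\{r_b<r<r_1\}$ and the ''$+$'' state on $\Omega^+=\{r_0<r<r_b\}$ (continuous up to the closures), solving (E) in $\Omega^\pm$, with at $r=r_b$ the Rankine-Hugoniot conditions $[\rho U_1]=[\rho U_1^2+p]=[\rho U_1U_2]=[B]=0$, where $[v]=v^+(r_b)-v^-(r_b)$, and increase of entropy across the shock (equivalently $[p]>0$), and the boundary conditions $\rho(r_1)=\rho_0^-$, $U_1(r_1)=U_{10}^-$, $U_2(r_1)=U_{20}^-$, $A(r_1)=A_0^-$, $p(r_0)=p_{ex}$. The exit is $r=r_0$. The shock is called supersonic-supersonic, supersonic-sonic or supersonic-subsonic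 if the state ahead of it (the ''$-$'' state) is supersonic and the state just behind it (the ''$+$'' state at $r=r_b$) is supersonic, sonic or subsonic respectively. Constants and functions: $\kappa_1=r_1\rho_0^-U_{10}^-$, $\kappa_2=r_1U_{20}^-\neq0$, $B_0=\frac12\big((U_{10}^-)^2+(U_{20}^-)^2\big)+\frac{\gamma A_0^-}{\gamma-1}(\rho_0^-)^{\gamma-1}$, $$f_2(\rho)=\frac{\gamma p_{ex}}{\gamma-1}\rho-\left(B_0-\frac{\kappa_2^2}{2r_0^2}\right)\rho^2+\frac{\kappa_1^2}{2r_0^2},\qquad \rho^\sharp=\frac{\gamma(\gamma+1)p_{ex}}{2(\gamma-1)B_0},$$ $$K(r)=\frac{2(\gamma-1)}{\gamma+1}B_0-\frac{\gamma-1}{\gamma+1}\frac{\kappa_2^2}{r^2},\qquad \rho^{\sharp\sharp}=\frac{\gamma p_{ex}}{K(r_0)}\quad(\text{with }K(r_0)>0\text{ assumed}),$$ $$f_1(r)=\left(1-\frac{(\gamma+1)\kappa_2^2}{(\gamma-1)(2r^2B_0-\kappa_2^2)}\right)(M_1^-)^2(r),\qquad r_*=\sqrt{\frac{\gamma}{(\gamma-1)B_0}}\,|\kappa_2|,$$ where in $f_1$ the state ''$-$'' is the smooth solution of (E) with the given data at $r=r_1$, extended to its maximal interval $(r^{\sharp,-},\infty)$ of existence. $f_1$ is increasing for $r>r_*$ (where defined), and $r'_*$ denotes the unique $r>r_*$ with $f_1(r)=1$. *)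

(* Defs.v *)
(* Stdlib reals with Coquelicot. *)
From Stdlib Require Import Reals.
From Coquelicot Require Import Coquelicot.
Open Scope R_scope.

(* Total functions of the radius; each predicate below says on which set of
   radii the values are constrained.  The velocity is U1 e_r + U2 e_theta. *)
Record flow := Flow {
  U1 : R -> R;
  U2 : R -> R;
  rho : R -> R;
  p : R -> R;
  A : R -> R }.

Definition flow_agree (D : R -> Prop) (F G : flow) : Prop :=
  forall r, D r ->
    U1 F r = U1 G r /\ U2 F r = U2 G r /\ rho F r = rho G r /\
    p F r = p G r /\ A F r = A G r.

Definition continuous_flow_on (D : R -> Prop) (F : flow) : Prop :=
  continuous_on D (U1 F) /\ continuous_on D (U2 F) /\ continuous_on D (rho F) /\
  continuous_on D (p F) /\ continuous_on D (A F).

(* C^infinity; used on open sets D only. *)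
Definition smooth_on (D : R -> Prop) (f : R -> R) : Prop :=
  forall (n : nat) (r : R), D r -> ex_derive_n f n r.

Definition smooth_flow_on (D : R -> Prop) (F : flow) : Prop :=
  smooth_on D (U1 F) /\ smooth_on D (U2 F) /\ smooth_on D (rho F) /\
  smooth_on D (p F) /\ smooth_on D (A F).

(* [Rpower x y] is the real power only for x > 0. *)
Definition polytropic_on (gamma : R) (D : R -> Prop) (F : flow) : Prop :=
  forall r, D r ->
    0 < rho F r /\ 0 < A F r /\ p F r = A F r * Rpower (rho F r) gamma.

Definition steady_euler_at (F : flow) (r : R) : Prop :=
  Derive (fun s => rho F s * U1 F s) r + / r * (rho F r * U1 F r) = 0 /\
  U1 F r * Derive (U1 F) r + / rho F r * Derive (p F) r - U2 F r ^ 2 / r = 0 /\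
  U1 F r * Derive (U2 F) r + U1 F r * U2 F r / r = 0 /\
  U1 F r * Derive (A F) r = 0.

Definition smooth_euler_on (gamma : R) (D : R -> Prop) (F : flow) : Prop :=
  smooth_flow_on D F /\ polytropic_on gamma D F /\
  (forall r, D r -> steady_euler_at F r).

Definition speed2 (F : flow) (r : R) : R := U1 F r ^ 2 + U2 F r ^ 2.

Definition sound2 (gamma : R) (F : flow) (r : R) : R := gamma * p F r / rho F r.

Definition mach1_2 (gamma : R) (F : flow) (r : R) : R :=
  U1 F r ^ 2 / sound2 gamma F r.

Definition bernoulli (gamma : R) (F : flow) (r : R) : R :=
  / 2 * (U1 F r ^ 2 + U2 F r ^ 2) + gamma * p F r / ((gamma - 1) * rho F r).

Definition supersonic (gamma : R) (F : flow) (r : R) : Prop :=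
  sound2 gamma F r < speed2 F r.
Definition sonic (gamma : R) (F : flow) (r : R) : Prop :=
  speed2 F r = sound2 gamma F r.
Definition subsonic (gamma : R) (F : flow) (r : R) : Prop :=
  speed2 F r < sound2 gamma F r.

(* The fixed data: everything except the exit pressure.  The last four fields
   are prescribed at the entrance r = r1. *)
Record inflow := Inflow {
  gamma : R;
  r0 : R;
  r1 : R;
  rho_in : R;
  U1_in : R;
  U2_in : R;
  A_in : R }.

(* U1_in < 0: the fluid moves inwards, from r1 to the exit r0. *)
Definition admissible_inflow (d : inflow) : Prop :=
  1 < gamma d /\ 0 < r0 d /\ r0 d < r1 d /\
  0 < rho_in d /\ 0 < A_in d /\ U1_in d < 0 /\ U2_in d <> 0 /\
  gamma d * A_in d * Rpower (rho_in d) (gamma d - 1) < U1_in d ^ 2.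

Definition entrance_condition (d : inflow) (F : flow) : Prop :=
  rho F (r1 d) = rho_in d /\ U1 F (r1 d) = U1_in d /\
  U2 F (r1 d) = U2_in d /\ A F (r1 d) = A_in d.

Definition rankine_hugoniot (gamma : R) (Fm Fp : flow) (rb : R) : Prop :=
  rho Fp rb * U1 Fp rb = rho Fm rb * U1 Fm rb /\
  rho Fp rb * U1 Fp rb ^ 2 + p Fp rb = rho Fm rb * U1 Fm rb ^ 2 + p Fm rb /\
  rho Fp rb * U1 Fp rb * U2 Fp rb = rho Fm rb * U1 Fm rb * U2 Fm rb /\
  bernoulli gamma Fp rb = bernoulli gamma Fm rb.

(* A = p / rho^gamma is an increasing function of the specific entropy of a
   polytropic gas, and the fluid crosses the shock from "-" to "+". *)
Definition entropy_increases (Fm Fp : flow) (rb : R) : Prop :=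
  A Fm rb < A Fp rb.

(* Fm is the state ahead of the shock, on (rb, r1); Fp the one behind it, on
   (r0, rb).  Smoothness is required inside and continuity up to the ends: the
   derivatives of Fp may blow up at r0, where U1^2 = c^2 is possible. *)
Record problem_IV (d : inflow) (pex rb : R) (Fm Fp : flow) : Prop := {
  IV_position : r0 d < rb < r1 d;
  IV_euler_m : smooth_euler_on (gamma d) (fun r => rb < r < r1 d) Fm;
  IV_euler_p : smooth_euler_on (gamma d) (fun r => r0 d < r < rb) Fp;
  IV_cont_m : continuous_flow_on (fun r => rb <= r <= r1 d) Fm;
  IV_cont_p : continuous_flow_on (fun r => r0 d <= r <= rb) Fp;
  IV_gas_m : polytropic_on (gamma d) (fun r => rb <= r <= r1 d) Fm;
  IV_gas_p : polytropic_on (gamma d) (fun r => r0 d <= r <= rb) Fp;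
  IV_jump : rankine_hugoniot (gamma d) Fm Fp rb;
  IV_entropy : entropy_increases Fm Fp rb;
  IV_entrance : entrance_condition d Fm;
  IV_exit : p Fp (r0 d) = pex }.

Definition kappa1 (d : inflow) : R := r1 d * rho_in d * U1_in d.
Definition kappa2 (d : inflow) : R := r1 d * U2_in d.

Definition B0 (d : inflow) : R :=
  / 2 * (U1_in d ^ 2 + U2_in d ^ 2)
  + gamma d * A_in d / (gamma d - 1) * Rpower (rho_in d) (gamma d - 1).

Definition f2 (d : inflow) (pex x : R) : R :=
  gamma d * pex / (gamma d - 1) * x
  - (B0 d - kappa2 d ^ 2 / (2 * r0 d ^ 2)) * x ^ 2
  + kappa1 d ^ 2 / (2 * r0 d ^ 2).

Definition rho_sharp (d : inflow) (pex : R) : R :=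
  gamma d * (gamma d + 1) * pex / (2 * (gamma d - 1) * B0 d).

Definition K (d : inflow) (r : R) : R :=
  2 * (gamma d - 1) / (gamma d + 1) * B0 d
  - (gamma d - 1) / (gamma d + 1) * (kappa2 d ^ 2 / r ^ 2).

Definition rho_sharpsharp (d : inflow) (pex : R) : R :=
  gamma d * pex / K d (r0 d).

(* F is the smooth solution through the entrance data and (a, +oo) its maximal
   interval of existence. *)
Definition maximal_upstream (d : inflow) (a : R) (F : flow) : Prop :=
  (0 <= a < r1 d /\ smooth_euler_on (gamma d) (fun r => a < r) F /\
   entrance_condition d F) /\
  (forall (a' : R) (F' : flow),
     0 <= a' < r1 d -> smooth_euler_on (gamma d) (fun r => a' < r) F' ->
     entrance_condition d F' -> a <= a').

Definition f1 (d : inflow) (Fm : flow) (r : R) : R :=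
  (1 - (gamma d + 1) * kappa2 d ^ 2
       / ((gamma d - 1) * (2 * r ^ 2 * B0 d - kappa2 d ^ 2)))
  * mach1_2 (gamma d) Fm r.

Definition r_star (d : inflow) : R :=
  sqrt (gamma d / ((gamma d - 1) * B0 d)) * Rabs (kappa2 d).

Definition is_r_star' (d : inflow) (rs' : R) : Prop :=
  exists (a : R) (Fm : flow),
    maximal_upstream d a Fm /\ a < rs' /\ r_star d < rs' /\ f1 d Fm rs' = 1.

(* The "-" state is supersonic on the whole of [rb, r1], the "+" state is
   classified at the shock. *)
Definition shock_from_supersonic (behind : R -> flow -> R -> Prop)
    (d : inflow) (rb : R) (Fm Fp : flow) : Prop :=
  (forall r, rb <= r <= r1 d -> supersonic (gamma d) Fm r) /\
  behind (gamma d) Fp rb.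

Definition supersonic_supersonic_shock := shock_from_supersonic supersonic.
Definition supersonic_sonic_shock := shock_from_supersonic sonic.
Definition supersonic_subsonic_shock := shock_from_supersonic subsonic.

(* "Uniformly" = up to both ends of the closed interval, hence, by continuity,
   with |U|^2 - c^2 bounded away from 0. *)
Definition uniformly_subsonic (d : inflow) (rb : R) (Fp : flow) : Prop :=
  forall r, r0 d <= r <= rb -> subsonic (gamma d) Fp r.
Definition uniformly_supersonic (d : inflow) (rb : R) (Fp : flow) : Prop :=
  forall r, r0 d <= r <= rb -> supersonic (gamma d) Fp r.

(* The fluid moves inwards, so the subsonic part is the outer one; the passage
   is smooth because Fp is smooth on (r0, rb). *)
Definition subsonic_to_supersonic (d : inflow) (rb : R) (Fp : flow) : Prop :=
  exists rs, r0 d < rs < rb /\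
    (forall r, rs < r <= rb -> subsonic (gamma d) Fp r) /\
    sonic (gamma d) Fp rs /\
    (forall r, r0 d <= r < rs -> supersonic (gamma d) Fp r).

Definition subsonic_sonic_at_exit (d : inflow) (rb : R) (Fp : flow) : Prop :=
  (forall r, r0 d < r <= rb -> subsonic (gamma d) Fp r) /\
  sonic (gamma d) Fp (r0 d).

Definition supersonic_sonic_at_shock (d : inflow) (rb : R) (Fp : flow) : Prop :=
  (forall r, r0 d <= r < rb -> supersonic (gamma d) Fp r) /\
  sonic (gamma d) Fp rb.

Definition subsonic_shock_patterns (d : inflow) (pex rb : R) (Fm Fp : flow)
    : Prop :=
  (f2 d pex (rho_sharp d pex) < 0 ->
     supersonic_subsonic_shock d rb Fm Fp /\ uniformly_subsonic d rb Fp) /\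
  (0 < f2 d pex (rho_sharp d pex) ->
     supersonic_subsonic_shock d rb Fm Fp /\ subsonic_to_supersonic d rb Fp) /\
  (f2 d pex (rho_sharp d pex) = 0 ->
     supersonic_subsonic_shock d rb Fm Fp /\ subsonic_sonic_at_exit d rb Fp).

Definition solvable_pressure (d : inflow) (p1 p0 pex : R) : Prop :=
  0 < pex /\ f2 d pex (rho_sharpsharp d pex) <= 0 /\ p1 < pex < p0.

(* Main.v *)
Require Import Defs.
From Stdlib Require Import Reals Lra ClassicalEpsilon.
From Coquelicot Require Import Coquelicot.
Open Scope R_scope.

Set Bullet Behavior "Strict Subproofs".

(** Three quantities are constant along each smooth branch: the mass flux
    r rho U1, the angular momentum r U2 and the Bernoulli function B; these
    are also preserved by the shock.  The entropy function A is constant on each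
    branch and jumps.  At a given radius the state therefore depends on one
    unknown, the radial speed, which is measured here in units of the critical
    speed: z = - U1 / sqrt (K r).  In this unit the polytropic law separates,

        ln A + const = lam r + ell z,

    with [lam] strictly increasing and [ell] strictly increasing on (0, 1] and
    strictly decreasing beyond 1.  A branch of constant entropy is thus obtained
    by inverting [ell] on one side of its maximum: on z > 1 ([zsup]) for the
    incoming flow, on z <= 1 ([zsub]) behind the shock.  It can touch z = 1 only
    at its inner end ([sonic_only_at_inner_end]), which by continuity fixes the
    branch of any given solution ([upstream_branch], [downstream_branch]).
    Smoothness is obtained by noting that z satisfies a first-order equation
    whose right-hand side is a polynomial in a finite differentially closed
    family ([polynomial_smooth], [radial_generators_closed]).

    At the shock the momentum balance becomes z + 1/z = const, so the two sides
    satisfy z^- z^+ = 1 (Prandtl), and ln A jumps by ell (1/z) - ell z, which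
    is positive exactly for z^- > 1 and strictly increasing ([jump_increasing]).
    The free boundary problem is then equivalent to one scalar relation for the
    position r_b ([shock_at], with [shock_at_of_problem_IV] and
    [problem_IV_of_shock_at]).

    A shock further out meets a faster flow, creates more entropy, and leads to a
    larger z and hence a smaller pressure at the exit.  So the position is a
    decreasing function of p_ex, defined on the window between the pressures of
    a shock at the exit and of a shock at the entrance; the window is truncated
    where the flow behind the shock would reach z = 1 before the exit, which is
    what f2 (rho_sharpsharp) <= 0 expresses ([pressure_window]).

    For the classification, the excess |U|^2 - c^2 behind the shock increases
    inwards ([down_excess_decreasing]), so its signs at the shock and at the exit
    decide everything.  At the exit the sign is that of f2 (rho_sharp)
    ([f2_sharp_sign]); at the shock it is opposite to that of f1 - 1, which
    changes sign at r'_* ([margin_sign]). *)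

(** * Continuity, constancy and intermediate values on a closed interval *)

Definition clamp (a b x : R) : R := Rmax a (Rmin b x).

Lemma clamp_in (a b x : R) : a <= b -> a <= clamp a b x <= b.
Proof.
  intros Hab. unfold clamp, Rmax, Rmin.
  destruct (Rle_dec b x); destruct (Rle_dec a _); lra.
Qed.

Lemma clamp_id (a b x : R) : a <= x <= b -> clamp a b x = x.
Proof.
  intros Hx. unfold clamp. rewrite Rmin_right, Rmax_right; lra.
Qed.

Lemma clamp_contraction (a b x y : R) :
  Rabs (clamp a b y - clamp a b x) <= Rabs (y - x).
Proof.
  pose proof (Rle_abs (y - x)). pose proof (Rle_abs (- (y - x))) as Hn.
  rewrite Rabs_Ropp in Hn.
  apply Rabs_le. unfold clamp, Rmax, Rmin.
  destruct (Rle_dec b x), (Rle_dec b y);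
    repeat match goal with |- context [Rle_dec ?u ?v] => destruct (Rle_dec u v) end;
    lra.
Qed.

(** Composing with the retraction onto [a, b] turns continuity relative to the
    interval into continuity on the whole line, so that the classical theorems
    on functions of a real variable apply. *)
Lemma continuous_clamp (f : R -> R) (a b : R) :
  a <= b -> continuous_on (fun x => a <= x <= b) f ->
  forall x, continuous (fun y => f (clamp a b y)) x.
Proof.
  intros Hab Hf x.
  apply filterlim_locally; intros eps.
  pose proof (Hf (clamp a b x) (clamp_in a b x Hab)) as H.
  rewrite filterlim_locally in H.
  destruct (H eps) as [delta Hd].
  exists delta. intros y Hy. apply Hd.
  - eapply Rle_lt_trans; [apply clamp_contraction | exact Hy].
  - now apply clamp_in.
Qed.

Lemma constant_on_interval (f : R -> R) (a b : R) :
  continuous_on (fun x => a <= x <= b) f ->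
  (forall x, a < x < b -> is_derive f x 0) ->
  forall x y, a <= x <= b -> a <= y <= b -> f x = f y.
Proof.
  intros Hc Hd x y Hx Hy.
  assert (Hab : a <= b) by lra.
  destruct (MVT_gen (fun t => f (clamp a b t)) y x (fun _ => 0)) as [c [_ Hc']].
  - intros t Ht.
    assert (a < t < b)
      by (unfold Rmin, Rmax in Ht; destruct (Rle_dec y x); lra).
    apply is_derive_ext_loc with f; [| now apply Hd].
    assert (L : locally t (fun s => a < s < b))
      by (apply (open_and _ _ (open_gt a) (open_lt b)); lra).
    eapply filter_imp; [| exact L].
    intros s Hs. simpl. rewrite clamp_id; [reflexivity | lra].
  - intros t _. apply continuity_pt_filterlim. now apply continuous_clamp.
  - rewrite !clamp_id in Hc' by lra. lra.
Qed.

Lemma intermediate_value_on (f : R -> R) (a b y : R) :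
  a <= b -> continuous_on (fun x => a <= x <= b) f ->
  Rmin (f a) (f b) <= y <= Rmax (f a) (f b) ->
  exists x, a <= x <= b /\ f x = y.
Proof.
  intros Hab Hc Hy.
  destruct (IVT_gen (fun t => f (clamp a b t)) a b y) as [x [Hx Hfx]].
  - intros t. apply continuity_pt_filterlim. now apply continuous_clamp.
  - rewrite !clamp_id by lra. exact Hy.
  - rewrite Rmin_left, Rmax_right in Hx by lra.
    exists x. rewrite clamp_id in Hfx by lra. now split.
Qed.

Lemma crossing_down (f : R -> R) (a b y : R) :
  a <= b -> continuous_on (fun x => a <= x <= b) f -> f b < y < f a ->
  exists x, a < x < b /\ f x = y.
Proof.
  intros Hab Hc Hy.
  destruct (intermediate_value_on f a b y Hab Hc) as [x [Hx Hfx]].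
  - rewrite Rmin_right, Rmax_left; lra.
  - exists x. split; [| exact Hfx].
    destruct (Req_dec x a) as [-> | ?]; [lra |].
    destruct (Req_dec x b) as [-> | ?]; lra.
Qed.

Lemma crossing_up (f : R -> R) (a b y : R) :
  a <= b -> continuous_on (fun x => a <= x <= b) f -> f a < y < f b ->
  exists x, a < x < b /\ f x = y.
Proof.
  intros Hab Hc Hy.
  destruct (intermediate_value_on f a b y Hab Hc) as [x [Hx Hfx]].
  - rewrite Rmin_left, Rmax_right; lra.
  - exists x. split; [| exact Hfx].
    destruct (Req_dec x a) as [-> | ?]; [lra |].
    destruct (Req_dec x b) as [-> | ?]; lra.
Qed.

Lemma increasing_of_derive (f df : R -> R) (a b : R) :
  a < b -> (forall x, a <= x <= b -> is_derive f x (df x)) ->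
  (forall x, a < x < b -> 0 < df x) -> f a < f b.
Proof.
  intros Hab Hd Hpos.
  destruct (MVT_cor2 f df a b Hab) as [c [Ec Hc]].
  - intros c Hc. apply is_derive_Reals. now apply Hd.
  - assert (0 < df c * (b - a)) by (apply Rmult_lt_0_compat; [now apply Hpos | lra]).
    lra.
Qed.

(** * Smoothness of functions built from a differentially closed family *)

Inductive polynomial_in (G : (R -> R) -> Prop) : (R -> R) -> Prop :=
| poly_gen f : G f -> polynomial_in G f
| poly_const c : polynomial_in G (fun _ => c)
| poly_plus f g : polynomial_in G f -> polynomial_in G g ->
    polynomial_in G (fun x => f x + g x)
| poly_mult f g : polynomial_in G f -> polynomial_in G g ->
    polynomial_in G (fun x => f x * g x).

Definition differentially_closed (G : (R -> R) -> Prop) (D : R -> Prop) : Prop :=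
  forall g, G g ->
    exists h, polynomial_in G h /\ forall x, D x -> is_derive g x (h x).

Lemma polynomial_derive (G : (R -> R) -> Prop) (D : R -> Prop) :
  differentially_closed G D ->
  forall f, polynomial_in G f ->
    exists h, polynomial_in G h /\ forall x, D x -> is_derive f x (h x).
Proof.
  intros HG f Hf. induction Hf as [f Hf | c | f g _ IHf _ IHg | f g Hf IHf Hg IHg].
  - now apply HG.
  - exists (fun _ => 0). split; [apply poly_const |].
    intros x _. apply @is_derive_const.
  - destruct IHf as [f' [Pf Df]], IHg as [g' [Pg Dg]].
    exists (fun x => f' x + g' x). split; [now apply poly_plus |].
    intros x Hx. apply @is_derive_plus; auto.
  - destruct IHf as [f' [Pf Df]], IHg as [g' [Pg Dg]].
    exists (fun x => f' x * g x + f x * g' x). split.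
    + apply poly_plus; apply poly_mult; assumption.
    + intros x Hx. apply Derive.is_derive_mult; auto.
Qed.

(** The radial profiles solve a first-order equation whose right-hand side is a
    polynomial in finitely many functions of the radius; then so is every
    higher derivative, whence smoothness without any higher chain rule. *)
Lemma polynomial_smooth (G : (R -> R) -> Prop) (D : R -> Prop) :
  open D -> differentially_closed G D ->
  forall f, polynomial_in G f -> smooth_on D f.
Proof.
  intros HD HG f Hf.
  assert (Hn : forall n, exists h, polynomial_in G h /\
                 forall x, D x -> Derive_n f n x = h x).
  { induction n as [| n [h [Ph Eh]]].
    - exists f. split; [exact Hf | reflexivity].
    - destruct (polynomial_derive G D HG h Ph) as [h' [Ph' Dh]].
      exists h'. split; [exact Ph' |]. intros x Hx. simpl.
      apply is_derive_unique. apply is_derive_ext_loc with h; [| now apply Dh].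
      eapply filter_imp; [| exact (HD x Hx)].
      intros y Hy. symmetry. now apply Eh. }
  intros [| n] r Hr; [exact I |]. simpl.
  destruct (Hn n) as [h [Ph Eh]].
  destruct (polynomial_derive G D HG h Ph) as [h' [_ Dh]].
  exists (h' r). apply is_derive_ext_loc with h; [| now apply Dh].
  eapply filter_imp; [| exact (HD r Hr)].
  intros y Hy. symmetry. now apply Eh.
Qed.

Lemma smooth_on_ext (D : R -> Prop) (f g : R -> R) :
  open D -> (forall x, D x -> f x = g x) -> smooth_on D f -> smooth_on D g.
Proof.
  intros HD Hfg Hf n r Hr.
  apply ex_derive_n_ext_loc with f; [| now apply Hf].
  eapply filter_imp; [| exact (HD r Hr)]. exact Hfg.
Qed.

Lemma open_interval (a b : R) : open (fun x => a < x < b).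
Proof. apply open_and; [apply open_gt | apply open_lt]. Qed.

(** * Inverting a monotone function *)

(** Values above the maximum [phi hi] are sent to [hi], so that the inverse is
    defined on the whole line and stays continuous there. *)
Lemma capped_inverse_exists (phi : R -> R) (lo hi v : R) :
  lo < hi -> (forall z, lo < z <= hi -> continuous phi z) ->
  (exists z, lo < z <= hi /\ phi z <= v) ->
  exists z, lo < z <= hi /\ phi z = Rmin v (phi hi).
Proof.
  intros Hlh Hc [z0 [Hz0 Hv]].
  destruct (Rle_lt_dec (phi hi) v) as [H | H].
  - exists hi. rewrite Rmin_right by assumption. lra.
  - rewrite Rmin_left by lra.
    destruct (intermediate_value_on phi z0 hi v) as [z [Hz Hfz]].
    + lra.
    + apply continuous_on_forall. intros z Hz. apply Hc. lra.
    + rewrite Rmin_left, Rmax_right; lra.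
    + exists z. split; [lra | exact Hfz].
Qed.

Lemma capped_inverse_continuous (phi g : R -> R) (lo hi : R) :
  (forall x y, lo < x -> x < y -> y <= hi -> phi x < phi y) ->
  (forall v, lo < g v <= hi /\ phi (g v) = Rmin v (phi hi)) ->
  forall v, continuous g v.
Proof.
  intros Hincr Hg v0.
  assert (Hle : forall x y, lo < x <= hi -> lo < y <= hi ->
                  phi x < phi y -> x < y).
  { intros x y Hx Hy Hxy. destruct (Rtotal_order x y) as [? | [-> | ?]];
      [assumption | lra |]. specialize (Hincr y x). lra. }
  apply filterlim_locally. intros eps.
  destruct (Hg v0) as [Hz0 E0]. set (z0 := g v0) in *.
  pose proof (cond_pos eps) as Heps.
  assert (Lo : locally v0 (fun v => z0 - eps < g v)).
  { set (z1 := Rmax (z0 - eps) ((lo + z0) / 2)).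
    assert (H1 : lo < z1 < z0 /\ z0 - eps <= z1).
    { unfold z1. split; [| apply Rmax_l]. unfold Rmax. destruct Rle_dec; lra. }
    assert (H2 : phi z1 < Rmin v0 (phi hi)) by (rewrite <- E0; apply Hincr; lra).
    pose proof (Rmin_l v0 (phi hi)). pose proof (Rmin_r v0 (phi hi)).
    eapply filter_imp; [| apply (open_gt (phi z1)); simpl; lra].
    intros v Hv. destruct (Hg v) as [Hgv Ev].
    assert (z1 < g v); [| lra].
    apply Hle; [lra | assumption |]. rewrite Ev.
    apply Rmin_glb_lt; lra. }
  assert (Up : locally v0 (fun v => g v < z0 + eps)).
  { destruct (Rlt_le_dec hi (z0 + eps)) as [H | H].
    - apply filter_forall. intros v. destruct (Hg v). lra.
    - assert (H1 : phi z0 < phi (z0 + eps)) by (apply Hincr; lra).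
      assert (H2 : phi (z0 + eps) <= phi hi).
      { destruct (Req_dec (z0 + eps) hi) as [-> | ?]; [lra |].
        left. apply Hincr; lra. }
      assert (H3 : phi z0 = v0).
      { rewrite E0. apply Rmin_left. unfold Rmin in E0.
        destruct (Rle_dec v0 (phi hi)); lra. }
      eapply filter_imp; [| apply (open_lt (phi (z0 + eps))); simpl; lra].
      intros v Hv. destruct (Hg v) as [Hgv Ev]. apply Hle; [assumption | lra |].
      rewrite Ev. eapply Rle_lt_trans; [apply Rmin_l | exact Hv]. }
  generalize (filter_and _ _ Lo Up). apply filter_imp.
  intros v [Hv1 Hv2]. unfold ball; simpl; unfold AbsRing_ball, abs, minus, plus, opp; simpl.
  apply Rabs_def1; lra.
Qed.

Lemma is_derive_right_inverse (phi g : R -> R) (v0 l : R) :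
  continuous g v0 -> locally v0 (fun v => phi (g v) = v) ->
  is_derive phi (g v0) l -> l <> 0 -> is_derive g v0 (/ l).
Proof.
  intros Hc Hinv Hd Hl.
  assert (Hv0 : phi (g v0) = v0) by exact (locally_singleton _ _ Hinv).
  apply is_derive_Reals. apply is_derive_Reals in Hd.
  assert (Hla : 0 < Rabs l) by now apply Rabs_pos_lt.
  intros eps Heps.
  (* |phi (g v) - v0 - l h| <= e |h| with h = g v - g v0, hence
     |h| <= 2 |v - v0| / |l| as soon as e <= |l| / 2. *)
  set (e := Rmin (Rabs l / 2) (eps * Rabs l * Rabs l / 4)).
  assert (He : 0 < e /\ e <= Rabs l / 2 /\ e <= eps * Rabs l * Rabs l / 4).
  { assert (0 < eps * Rabs l * Rabs l) by (repeat apply Rmult_lt_0_compat; lra).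
    unfold e. split; [apply Rmin_glb_lt; lra | split; [apply Rmin_l | apply Rmin_r]]. }
  destruct (Hd e (proj1 He)) as [d1 Hd1].
  pose proof (proj1 (filterlim_locally _ _) Hc d1) as Hc1.
  destruct (filter_and _ _ Hinv Hc1) as [d2 Hd2].
  exists d2. intros k Hk0 Hk.
  destruct (Hd2 (v0 + k)) as [Ek Bk].
  { unfold ball; simpl; unfold AbsRing_ball, abs, minus, plus, opp; simpl.
    replace (v0 + k + - v0) with k by ring. exact Hk. }
  unfold ball in Bk; simpl in Bk; unfold AbsRing_ball, abs, minus, plus, opp in Bk; simpl in Bk.
  set (h := g (v0 + k) - g v0).
  assert (Hh0 : h <> 0).
  { intros E. unfold h in E. replace (g (v0 + k)) with (g v0) in Ek by lra. lra. }
  assert (Hh : Rabs ((phi (g v0 + h) - phi (g v0)) / h - l) < e)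
    by (apply Hd1; assumption).
  replace (g v0 + h) with (g (v0 + k)) in Hh by (unfold h; ring).
  rewrite Ek, Hv0 in Hh. replace (v0 + k - v0) with k in Hh by ring.
  replace (k / h - l) with ((k - l * h) / h) in Hh by (field; assumption).
  unfold Rdiv in Hh. rewrite Rabs_mult, Rabs_inv in Hh.
  assert (Hha : 0 < Rabs h) by now apply Rabs_pos_lt.
  assert (Hka : 0 < Rabs k) by now apply Rabs_pos_lt.
  assert (H1 : Rabs (k - l * h) < e * Rabs h).
  { apply Rmult_lt_reg_r with (/ Rabs h); [now apply Rinv_0_lt_compat |].
    rewrite Rmult_assoc, Rinv_r by lra. lra. }
  assert (H2 : Rabs l * Rabs h <= 2 * Rabs k).
  { rewrite <- Rabs_mult.
    pose proof (Rabs_triang_inv (l * h) (l * h - k)) as T.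
    replace (l * h - (l * h - k)) with k in T by ring.
    rewrite (Rabs_minus_sym (l * h) k) in T.
    assert (e * Rabs h <= Rabs l / 2 * Rabs h) by (apply Rmult_le_compat_r; lra).
    rewrite (Rabs_mult l h) in *. lra. }
  fold h.
  replace (h / k - / l) with (- (k - l * h) * / (l * k)) by (field; split; assumption).
  rewrite Rabs_mult, Rabs_Ropp, Rabs_inv, Rabs_mult.
  assert (Hlk : 0 < Rabs l * Rabs k) by now apply Rmult_lt_0_compat.
  apply Rmult_lt_reg_r with (Rabs l * Rabs k); [exact Hlk |].
  rewrite Rmult_assoc, Rinv_l, Rmult_1_r by lra.
  eapply Rlt_le_trans; [exact H1 |].
  apply Rle_trans with (eps * Rabs l * Rabs l / 4 * Rabs h).
  - apply Rmult_le_compat_r; lra.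
  - replace (eps * Rabs l * Rabs l / 4 * Rabs h)
      with (eps * Rabs l / 4 * (Rabs l * Rabs h)) by field.
    assert (eps * Rabs l / 4 * (Rabs l * Rabs h) <= eps * Rabs l / 4 * (2 * Rabs k)).
    { apply Rmult_le_compat_l; [| assumption].
      assert (0 < eps * Rabs l) by (apply Rmult_lt_0_compat; lra). lra. }
    assert (0 < eps * (Rabs l * Rabs k)) by now apply Rmult_lt_0_compat.
    lra.
Qed.
(** * The entropy profile of a radial Mach number *)

(** The square of the largest radial speed compatible with the Bernoulli law,
    in units of the critical speed. *)
Definition zlim2 (g : R) : R := (g + 1) / (g - 1).

(** At a given radius and mass flux, ln A is, up to a constant, [ell] of the
    radial speed measured in units of the local critical speed sqrt K. *)
Definition ell (g z : R) : R := (g - 1) * ln z + ln (zlim2 g - z ^ 2).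

Definition physical (g z : R) : Prop := 0 < z /\ z ^ 2 < zlim2 g.

Lemma zlim2_gt_1 (g : R) : 1 < g -> 1 < zlim2 g.
Proof.
  intros Hg. unfold zlim2. apply Rmult_lt_reg_r with (g - 1); [lra |].
  unfold Rdiv. rewrite Rmult_assoc, Rinv_l; lra.
Qed.

Lemma physical_subcritical (g z : R) : 1 < g -> 0 < z <= 1 -> physical g z.
Proof.
  intros Hg Hz. pose proof (zlim2_gt_1 g Hg). split; [lra | nra].
Qed.

Lemma ell_derive (g z : R) : 1 < g -> physical g z ->
  is_derive (ell g) z ((g + 1) * (1 - z ^ 2) / (z * (zlim2 g - z ^ 2))).
Proof.
  intros Hg [Hz Hz2]. unfold ell, zlim2 in *.
  evar_last.
  - apply @is_derive_plus.
    + apply is_derive_scal, is_derive_ln, Hz.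
    + apply (is_derive_comp ln (fun t => (g + 1) / (g - 1) - t ^ 2)).
      * apply is_derive_ln. lra.
      * auto_derive; [exact I | reflexivity].
  - unfold plus, scal; simpl; unfold mult; simpl. field. repeat split; try lra.
    intros E. apply Rlt_not_le in Hz2. apply Hz2.
    apply Rmult_le_reg_r with (g - 1); [lra |].
    unfold Rdiv. rewrite Rmult_assoc, Rinv_l by lra. lra.
Qed.

Lemma ell_continuous (g z : R) : 1 < g -> physical g z -> continuous (ell g) z.
Proof.
  intros Hg Hz. apply @ex_derive_continuous. eexists. now apply ell_derive.
Qed.

Lemma ell_increasing (g x y : R) : 1 < g -> 0 < x -> x < y -> y <= 1 ->
  ell g x < ell g y.
Proof.
  intros Hg Hx Hxy Hy.
  apply (increasing_of_derive (ell g)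
           (fun z => (g + 1) * (1 - z ^ 2) / (z * (zlim2 g - z ^ 2))));
    [exact Hxy | |]; intros z Hz.
  - apply ell_derive; [exact Hg |]. apply physical_subcritical; lra.
  - destruct (physical_subcritical g z Hg) as [_ H]; [lra |].
    apply Rdiv_lt_0_compat; apply Rmult_lt_0_compat; nra.
Qed.

Lemma ell_decreasing (g x y : R) : 1 < g -> 1 <= x -> x < y -> y ^ 2 < zlim2 g ->
  ell g y < ell g x.
Proof.
  intros Hg Hx Hxy Hy. apply Ropp_lt_cancel.
  apply (increasing_of_derive (fun z => - ell g z)
           (fun z => - ((g + 1) * (1 - z ^ 2) / (z * (zlim2 g - z ^ 2)))));
    [exact Hxy | |]; intros z Hz.
  - apply @is_derive_opp, ell_derive; [exact Hg |]. split; [lra | nra].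
  - replace (- ((g + 1) * (1 - z ^ 2) / (z * (zlim2 g - z ^ 2))))
      with ((g + 1) * (z ^ 2 - 1) / (z * (zlim2 g - z ^ 2))).
    + apply Rdiv_lt_0_compat; apply Rmult_lt_0_compat; nra.
    + unfold Rdiv. ring.
Qed.

Lemma ell_max (g z : R) : 1 < g -> physical g z -> z <> 1 -> ell g z < ell g 1.
Proof.
  intros Hg [Hz Hz2] Hne. destruct (Rtotal_order z 1) as [H | [H | H]].
  - apply ell_increasing; lra.
  - lra.
  - apply ell_decreasing; lra.
Qed.

Lemma ell_le_max (g z : R) : 1 < g -> physical g z -> ell g z <= ell g 1.
Proof.
  intros Hg Hz. destruct (Req_dec z 1) as [-> | Hne]; [lra |].
  left. now apply ell_max.
Qed.

Lemma ell_sub_lt (g x y : R) : 1 < g -> 0 < x <= 1 -> 0 < y <= 1 ->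
  ell g x < ell g y -> x < y.
Proof.
  intros Hg Hx Hy H. destruct (Rtotal_order x y) as [? | [-> | E]]; try lra.
  assert (ell g y < ell g x) by (apply ell_increasing; lra). lra.
Qed.

Lemma ell_sub_inj (g x y : R) : 1 < g -> 0 < x <= 1 -> 0 < y <= 1 ->
  ell g x = ell g y -> x = y.
Proof.
  intros Hg Hx Hy H. destruct (Rtotal_order x y) as [E | [? | E]]; [| assumption |].
  - assert (ell g x < ell g y) by (apply ell_increasing; lra). lra.
  - assert (ell g y < ell g x) by (apply ell_increasing; lra). lra.
Qed.

Definition supercritical (g z : R) : Prop := 1 <= z /\ z ^ 2 < zlim2 g.

Lemma supercritical_physical (g z : R) : supercritical g z -> physical g z.
Proof. intros [H1 H2]. split; [lra | exact H2]. Qed.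

Lemma ell_sup_lt (g x y : R) : 1 < g -> supercritical g x -> supercritical g y ->
  ell g x < ell g y -> y < x.
Proof.
  intros Hg [Hx Hx2] [Hy Hy2] H. destruct (Rtotal_order x y) as [E | [-> | ?]]; try lra.
  assert (ell g y < ell g x) by (apply ell_decreasing; lra). lra.
Qed.

Lemma ell_sup_inj (g x y : R) : 1 < g -> supercritical g x -> supercritical g y ->
  ell g x = ell g y -> x = y.
Proof.
  intros Hg [Hx Hx2] [Hy Hy2] H.
  destruct (Rtotal_order x y) as [E | [? | E]]; [| assumption |].
  - assert (ell g y < ell g x) by (apply ell_decreasing; lra). lra.
  - assert (ell g x < ell g y) by (apply ell_decreasing; lra). lra.
Qed.

(** * Entropy jump across a normal shock *)

(** By the Prandtl relation the two sides of the shock have reciprocal radial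
    speeds in units of the critical speed, so this is the jump of ln A. *)
Definition jump (g z : R) : R := ell g (/ z) - ell g z.

Lemma inv_subcritical (z : R) : 1 <= z -> 0 < / z <= 1.
Proof.
  intros Hz. split; [apply Rinv_0_lt_compat; lra |].
  rewrite <- Rinv_1. apply Rinv_le_contravar; lra.
Qed.

(** With Z = z^2 this is a positive multiple of (Z - 1)^2: the two terms cancel
    to second order, so that entropy production vanishes to third order with the
    strength of the shock. *)
Lemma jump_derivative_positive (a z : R) : 1 < a -> 1 < z -> z ^ 2 < a ->
  0 < - / z ^ 2 * (2 * a / (a - 1) * (1 - (/ z) ^ 2) / (/ z * (a - (/ z) ^ 2)))
      - 2 * a / (a - 1) * (1 - z ^ 2) / (z * (a - z ^ 2)).
Proof.
  intros Ha Hz Hz2.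
  assert (Hz1 : 1 < z ^ 2) by nra.
  assert (Haz : 1 < a * z ^ 2) by nra.
  match goal with |- 0 < ?e => replace e
    with (2 * a * (a + 1) * (z ^ 2 - 1) ^ 2
          / ((a - 1) * (z * ((a * z ^ 2 - 1) * (a - z ^ 2)))))
  end.
  - apply Rdiv_lt_0_compat.
    + repeat apply Rmult_lt_0_compat; lra.
    + repeat apply Rmult_lt_0_compat; lra.
  - field. repeat split; lra.
Qed.

Lemma jump_increasing (g x y : R) : 1 < g -> 1 <= x -> x < y -> y ^ 2 < zlim2 g ->
  jump g x < jump g y.
Proof.
  intros Hg Hx Hxy Hy.
  pose (d z := (g + 1) * (1 - z ^ 2) / (z * (zlim2 g - z ^ 2))).
  apply (increasing_of_derive (jump g)
           (fun z => - / z ^ 2 * d (/ z) - d z)); [exact Hxy | |]; intros z Hz.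
  - unfold jump. apply @is_derive_minus.
    + apply (is_derive_comp (ell g) Rinv).
      * apply ell_derive; [exact Hg |]. apply physical_subcritical; [exact Hg |].
        apply inv_subcritical; lra.
      * evar_last; [apply is_derive_inv; [apply @is_derive_id | lra] |].
        unfold one; simpl. field. lra.
    + apply ell_derive; [exact Hg |]. split; [lra | nra].
  - pose proof (zlim2_gt_1 g Hg) as Ha. assert (Hz2 : z ^ 2 < zlim2 g) by nra.
    assert (Eg : g = (zlim2 g + 1) / (zlim2 g - 1)).
    { unfold zlim2. field. split; [lra |].
      replace (g + 1 - (g - 1)) with 2 by ring. lra. }
    assert (Eg1 : g + 1 = 2 * zlim2 g / (zlim2 g - 1)).
    { rewrite Eg at 1. field. lra. }
    unfold d. rewrite Eg1. apply jump_derivative_positive; lra.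
Qed.

Lemma jump_1 (g : R) : jump g 1 = 0.
Proof. unfold jump. rewrite Rinv_1. ring. Qed.

Lemma jump_positive (g z : R) : 1 < g -> 1 < z -> z ^ 2 < zlim2 g -> 0 < jump g z.
Proof. intros Hg Hz Hz2. rewrite <- (jump_1 g). apply jump_increasing; lra. Qed.

Lemma compressive (g zm zp : R) : 1 < g -> physical g zm -> physical g zp ->
  zm * zp = 1 -> ell g zm < ell g zp -> 1 < zm /\ zp = / zm.
Proof.
  intros Hg [Hm Hm2] [Hp Hp2] E Hl.
  assert (Ep : zp = / zm) by (field_simplify_eq; lra).
  split; [| exact Ep]. apply Rnot_le_lt. intros H.
  destruct (Req_dec zm 1) as [E1 | Hne].
  - rewrite Ep, E1, Rinv_1 in Hl. lra.
  - assert (Em : zm = / zp) by (field_simplify_eq; lra).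
    assert (H1 : 1 < zp) by (rewrite Ep, <- Rinv_1; apply Rinv_lt_contravar; lra).
    pose proof (jump_positive g zp Hg H1 Hp2) as J.
    unfold jump in J. rewrite <- Em in J. lra.
Qed.

(** * The two branches of the inverse of the entropy profile *)

(** Both inverses are extended by the critical value 1 above the maximum [ell g 1],
    which makes them continuous on the whole line, in particular up to a choked
    end of the flow. *)
Definition zsub (g v : R) : R :=
  epsilon (inhabits 0) (fun z => 0 < z <= 1 /\ ell g z = Rmin v (ell g 1)).

Definition zsup (g v : R) : R :=
  epsilon (inhabits 0) (fun z => supercritical g z /\ ell g z = Rmin v (ell g 1)).

Lemma zsub_spec (g v : R) : 1 < g ->
  0 < zsub g v <= 1 /\ ell g (zsub g v) = Rmin v (ell g 1).
Proof.
  intros Hg. unfold zsub. apply epsilon_spec.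
  apply (capped_inverse_exists (ell g) 0 1 v); [lra | |].
  - intros z Hz. apply ell_continuous; [| apply physical_subcritical]; assumption.
  - (* ell z <= (g - 1) ln z + ln a, so a small z works. *)
    pose proof (zlim2_gt_1 g Hg) as Ha.
    set (w := Rmin 0 ((v - ln (zlim2 g)) / (g - 1))).
    assert (Hw : w <= 0 /\ w <= (v - ln (zlim2 g)) / (g - 1))
      by (split; [apply Rmin_l | apply Rmin_r]).
    assert (H1 : 0 < exp w <= 1).
    { split; [apply exp_pos |]. rewrite <- exp_0.
      destruct (Req_dec w 0) as [-> | ?]; [lra |]. left. apply exp_increasing. lra. }
    exists (exp w). split; [exact H1 |]. unfold ell. rewrite ln_exp.
    assert (ln (zlim2 g - exp w ^ 2) <= ln (zlim2 g)) by (apply ln_le; nra).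
    assert ((g - 1) * w <= v - ln (zlim2 g)); [| lra].
    replace (v - ln (zlim2 g)) with ((g - 1) * ((v - ln (zlim2 g)) / (g - 1)))
      by (field; lra).
    apply Rmult_le_compat_l; lra.
Qed.

Lemma zsup_spec (g v : R) : 1 < g ->
  supercritical g (zsup g v) /\ ell g (zsup g v) = Rmin v (ell g 1).
Proof.
  intros Hg. unfold zsup. apply epsilon_spec.
  pose proof (zlim2_gt_1 g Hg) as Ha. set (a := zlim2 g) in *.
  assert (Hs : 1 < sqrt a) by (rewrite <- sqrt_1; apply sqrt_lt_1; lra).
  assert (Hs2 : sqrt a ^ 2 = a) by (apply pow2_sqrt; lra).
  assert (Hin : forall z, - sqrt a < z <= -1 -> supercritical g (- z)).
  { intros z Hz. split; [lra |]. fold a. rewrite <- Hs2. nra. }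
  destruct (capped_inverse_exists (fun z => ell g (- z)) (- sqrt a) (-1) v)
    as [z [Hz Ez]].
  - lra.
  - intros z Hz. apply (continuous_comp Ropp (ell g)).
    + apply @continuous_opp, continuous_id.
    + apply ell_continuous; [exact Hg |]. apply supercritical_physical. now apply Hin.
  - (* ell z <= (g - 1) ln (sqrt a) + ln (a - z^2): take a - z^2 small. *)
    set (w := Rmin (ln (a - 1)) (v - (g - 1) * ln (sqrt a))).
    assert (Hw : w <= ln (a - 1) /\ w <= v - (g - 1) * ln (sqrt a))
      by (split; [apply Rmin_l | apply Rmin_r]).
    assert (He : 0 < exp w <= a - 1).
    { split; [apply exp_pos |]. rewrite <- (exp_ln (a - 1)) by lra.
      destruct (Req_dec w (ln (a - 1))) as [-> | ?]; [lra |].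
      left. apply exp_increasing. lra. }
    set (y := sqrt (a - exp w)).
    assert (Hy2 : y ^ 2 = a - exp w) by (apply pow2_sqrt; lra).
    assert (Hy : 1 <= y < sqrt a).
    { split; [rewrite <- sqrt_1; apply sqrt_le_1 |apply sqrt_lt_1]; lra. }
    exists (- y). split; [lra |]. unfold ell. rewrite Ropp_involutive. fold a.
    rewrite Hy2. replace (a - (a - exp w)) with (exp w) by ring. rewrite ln_exp.
    assert (ln y <= ln (sqrt a)) by (apply ln_le; lra).
    assert ((g - 1) * ln y <= (g - 1) * ln (sqrt a)) by (apply Rmult_le_compat_l; lra).
    lra.
  - exists (- z). split; [now apply Hin |].
    replace (- -1) with 1 in Ez by ring. exact Ez.
Qed.

Lemma zsub_ell (g v : R) : 1 < g -> v <= ell g 1 -> ell g (zsub g v) = v.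
Proof. intros Hg Hv. rewrite (proj2 (zsub_spec g v Hg)). now apply Rmin_left. Qed.

Lemma zsup_ell (g v : R) : 1 < g -> v <= ell g 1 -> ell g (zsup g v) = v.
Proof. intros Hg Hv. rewrite (proj2 (zsup_spec g v Hg)). now apply Rmin_left. Qed.

Lemma zsub_unique (g v z : R) : 1 < g -> 0 < z <= 1 -> ell g z = v -> zsub g v = z.
Proof.
  intros Hg Hz E. apply ell_sub_inj with g; [exact Hg | now apply zsub_spec | exact Hz |].
  rewrite E. apply zsub_ell; [exact Hg |]. rewrite <- E.
  apply ell_le_max; [| apply physical_subcritical]; assumption.
Qed.

Lemma zsup_unique (g v z : R) : 1 < g -> supercritical g z -> ell g z = v ->
  zsup g v = z.
Proof.
  intros Hg Hz E. apply ell_sup_inj with g; [exact Hg | now apply zsup_spec | exact Hz |].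
  rewrite E. apply zsup_ell; [exact Hg |]. rewrite <- E.
  apply ell_le_max; [| apply supercritical_physical]; assumption.
Qed.

Lemma zsub_lt_1 (g v : R) : 1 < g -> v < ell g 1 -> zsub g v < 1.
Proof.
  intros Hg Hv. apply (ell_sub_lt g); [exact Hg | now apply zsub_spec | lra |].
  rewrite zsub_ell; lra.
Qed.

Lemma zsup_gt_1 (g v : R) : 1 < g -> v < ell g 1 -> 1 < zsup g v.
Proof.
  intros Hg Hv. pose proof (zlim2_gt_1 g Hg).
  apply (ell_sup_lt g); [exact Hg | now apply zsup_spec | split; lra |].
  rewrite zsup_ell; lra.
Qed.

Lemma zsub_increasing (g u v : R) : 1 < g -> u < v -> v <= ell g 1 ->
  zsub g u < zsub g v.
Proof.
  intros Hg Huv Hv. apply (ell_sub_lt g); try apply zsub_spec; try exact Hg.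
  rewrite !zsub_ell; lra.
Qed.

Lemma zsup_decreasing (g u v : R) : 1 < g -> u < v -> v <= ell g 1 ->
  zsup g v < zsup g u.
Proof.
  intros Hg Huv Hv. apply (ell_sup_lt g); try apply zsup_spec; try exact Hg.
  rewrite !zsup_ell; lra.
Qed.

Lemma zsub_continuous (g v : R) : 1 < g -> continuous (zsub g) v.
Proof.
  intros Hg. apply (capped_inverse_continuous (ell g) (zsub g) 0 1).
  - intros x y Hx Hxy Hy. now apply ell_increasing.
  - intros w. now apply zsub_spec.
Qed.

Lemma zsup_continuous (g v : R) : 1 < g -> continuous (zsup g) v.
Proof.
  intros Hg.
  pose proof (zlim2_gt_1 g Hg) as Ha.
  assert (Hs2 : sqrt (zlim2 g) ^ 2 = zlim2 g) by (apply pow2_sqrt; lra).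
  pose proof (sqrt_pos (zlim2 g)) as Hs.
  apply continuous_ext with (fun w => - - zsup g w); [intros w; apply Ropp_involutive |].
  apply @continuous_opp.
  apply (capped_inverse_continuous (fun z => ell g (- z)) (fun w => - zsup g w)
           (- sqrt (zlim2 g)) (-1)).
  - intros x y Hx Hxy Hy. apply ell_decreasing; try lra. rewrite <- Hs2. nra.
  - intros w. rewrite Ropp_involutive. replace (- -1) with 1 by ring.
    destruct (zsup_spec g w Hg) as [[H1 H2] H3]. split; [| exact H3].
    split; [| lra]. rewrite <- Hs2 in H2. nra.
Qed.

(** Reciprocal of the derivative of [ell]. *)
Definition dbranch (g z : R) : R := z * (zlim2 g - z ^ 2) / ((g + 1) * (1 - z ^ 2)).

Lemma branch_derive (g v : R) (b : R -> R) : 1 < g -> continuous b v ->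
  locally v (fun w => ell g (b w) = w) -> physical g (b v) -> b v <> 1 ->
  is_derive b v (dbranch g (b v)).
Proof.
  intros Hg Hc Hinv Hb Hne. pose proof Hb as [Hz Hz2].
  assert (1 - b v ^ 2 <> 0).
  { replace (1 - b v ^ 2) with ((1 - b v) * (1 + b v)) by ring.
    apply Rmult_integral_contrapositive_currified; lra. }
  evar_last.
  - apply (is_derive_right_inverse (ell g)); [exact Hc | exact Hinv | |].
    + now apply ell_derive.
    + apply Rmult_integral_contrapositive_currified.
      * apply Rmult_integral_contrapositive_currified; lra.
      * apply Rinv_neq_0_compat, Rmult_integral_contrapositive_currified; lra.
  - unfold dbranch. field. repeat split; lra.
Qed.

Lemma zsub_derive (g v : R) : 1 < g -> v < ell g 1 ->
  is_derive (zsub g) v (dbranch g (zsub g v)).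
Proof.
  intros Hg Hv. apply branch_derive; [exact Hg | now apply zsub_continuous | | |].
  - eapply filter_imp; [| exact (open_lt (ell g 1) v Hv)].
    intros w Hw. apply zsub_ell; [exact Hg | now left].
  - apply physical_subcritical; [exact Hg | now apply zsub_spec].
  - apply Rlt_not_eq. now apply zsub_lt_1.
Qed.

Lemma zsup_derive (g v : R) : 1 < g -> v < ell g 1 ->
  is_derive (zsup g) v (dbranch g (zsup g v)).
Proof.
  intros Hg Hv. apply branch_derive; [exact Hg | now apply zsup_continuous | | |].
  - eapply filter_imp; [| exact (open_lt (ell g 1) v Hv)].
    intros w Hw. apply zsup_ell; [exact Hg | now left].
  - now apply supercritical_physical, zsup_spec.
  - apply Rgt_not_eq. now apply zsup_gt_1.
Qed.
(** * Radial states of the gas *)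

(** The part of ln A that depends on the radius alone; see [ell]. *)
Definition lam (d : inflow) (r : R) : R :=
  (gamma d + 1) / 2 * ln (K d r) + (gamma d - 1) * ln r.

Definition dlam (d : inflow) (r : R) : R :=
  (gamma d - 1) * kappa2 d ^ 2 / (r ^ 3 * K d r) + (gamma d - 1) / r.

Definition entropy_const (d : inflow) (alpha : R) : R :=
  ln alpha + (gamma d - 1) * ln (- kappa1 d)
  - ln ((gamma d - 1) / (2 * gamma d)).

(** The flow whose mass flux, angular momentum and Bernoulli constant are those
    of the inflow and whose radial speed is [z] times the critical speed. *)
Definition polar_flow (d : inflow) (z : R -> R) (alpha : R) : flow :=
  Flow (fun r => - (z r * sqrt (K d r)))
       (fun r => kappa2 d / r)
       (fun r => - kappa1 d / (r * (z r * sqrt (K d r))))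
       (fun r => - kappa1 d / (r * (z r * sqrt (K d r)))
                 * ((gamma d - 1) / (2 * gamma d)
                    * (K d r * (zlim2 (gamma d) - z r ^ 2))))
       (fun _ => alpha).

Record state (d : inflow) (r : R) (F : flow) (z : R) : Prop := {
  state_physical : physical (gamma d) z;
  state_U1 : U1 F r = - (z * sqrt (K d r));
  state_U2 : U2 F r = kappa2 d / r;
  state_rho : rho F r = - kappa1 d / (r * (z * sqrt (K d r)));
  state_p : p F r = - kappa1 d / (r * (z * sqrt (K d r)))
                    * ((gamma d - 1) / (2 * gamma d)
                       * (K d r * (zlim2 (gamma d) - z ^ 2)));
  state_A : 0 < A F r;
  state_entropy : entropy_const d (A F r) = lam d r + ell (gamma d) z }.

Lemma flux_positive (d : inflow) : admissible_inflow d -> 0 < - kappa1 d.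
Proof.
  intros (Hg & H0 & H1 & Hr & HA & HU & _). unfold kappa1.
  assert (0 < r1 d * rho_in d * (- U1_in d))
    by (repeat apply Rmult_lt_0_compat; lra). lra.
Qed.

Lemma K_bernoulli (d : inflow) (r : R) : 1 < gamma d -> r <> 0 ->
  (gamma d + 1) / (2 * (gamma d - 1)) * K d r = B0 d - kappa2 d ^ 2 / (2 * r ^ 2).
Proof. intros Hg Hr. unfold K. field. lra. Qed.

Lemma K_increasing (d : inflow) (x y : R) : admissible_inflow d ->
  0 < x -> x < y -> K d x < K d y.
Proof.
  intros (Hg & H0 & H1 & Hr & HA & HU & HU2 & _) Hx Hxy. unfold K.
  assert (Hk : 0 < kappa2 d ^ 2).
  { apply pow2_gt_0. unfold kappa2. apply Rmult_integral_contrapositive_currified; lra. }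
  assert (H : kappa2 d ^ 2 / y ^ 2 < kappa2 d ^ 2 / x ^ 2).
  { apply Rmult_lt_compat_l; [exact Hk |].
    apply Rinv_lt_contravar; [apply Rmult_lt_0_compat; nra | nra]. }
  assert (0 < (gamma d - 1) / (gamma d + 1)) by (apply Rdiv_lt_0_compat; lra).
  nra.
Qed.

Lemma K_positive (d : inflow) (x y : R) : admissible_inflow d ->
  0 < x -> x <= y -> 0 < K d x -> 0 < K d y.
Proof.
  intros Hd Hx [Hxy | <-] HK; [| exact HK].
  pose proof (K_increasing d x y Hd Hx Hxy). lra.
Qed.

Lemma K_derive (d : inflow) (r : R) : 1 < gamma d -> r <> 0 ->
  is_derive (K d) r (2 * ((gamma d - 1) / (gamma d + 1)) * kappa2 d ^ 2 / r ^ 3).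
Proof.
  intros Hg Hr. unfold K. auto_derive.
  - apply Rmult_integral_contrapositive_currified; lra.
  - field. lra.
Qed.

Lemma lam_derive (d : inflow) (r : R) : 1 < gamma d -> 0 < r -> 0 < K d r ->
  is_derive (lam d) r (dlam d r).
Proof.
  intros Hg Hr HK. unfold lam. evar_last.
  - apply @is_derive_plus; apply is_derive_scal.
    + apply (is_derive_comp ln (K d)); [now apply is_derive_ln |].
      apply K_derive; lra.
    + now apply is_derive_ln.
  - unfold plus, scal; simpl; unfold mult; simpl. unfold dlam. field.
    repeat split; lra.
Qed.

Lemma lam_increasing (d : inflow) (x y : R) : admissible_inflow d ->
  0 < x -> x < y -> 0 < K d x -> lam d x < lam d y.
Proof.
  intros Hd Hx Hxy HK. pose proof Hd as (Hg & _).
  pose proof (K_increasing d x y Hd Hx Hxy).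
  assert (ln (K d x) < ln (K d y)) by (apply ln_increasing; lra).
  assert (ln x < ln y) by (apply ln_increasing; lra).
  unfold lam. nra.
Qed.

Lemma lam_continuous (d : inflow) (r : R) : 1 < gamma d -> 0 < r -> 0 < K d r ->
  continuous (lam d) r.
Proof.
  intros Hg Hr HK. apply @ex_derive_continuous. eexists. now apply lam_derive.
Qed.

Lemma entropy_const_lt (d : inflow) (x y : R) : 0 < x -> 0 < y ->
  (x < y <-> entropy_const d x < entropy_const d y).
Proof.
  intros Hx Hy. unfold entropy_const. split; intros H.
  - assert (ln x < ln y) by now apply ln_increasing. lra.
  - apply ln_lt_inv; lra.
Qed.

Lemma entropy_const_inj (d : inflow) (x y : R) : 0 < x -> 0 < y ->
  entropy_const d x = entropy_const d y -> x = y.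
Proof. unfold entropy_const. intros Hx Hy H. apply ln_inv; lra. Qed.

(** The entropy relation is the logarithm of the polytropic law. *)
Lemma entropy_relation (d : inflow) (r z alpha : R) :
  admissible_inflow d -> 0 < r -> 0 < K d r -> physical (gamma d) z -> 0 < alpha ->
  let rh := - kappa1 d / (r * (z * sqrt (K d r))) in
  let e := (gamma d - 1) / (2 * gamma d) * (K d r * (zlim2 (gamma d) - z ^ 2)) in
  (rh * e = alpha * Rpower rh (gamma d) <->
   entropy_const d alpha = lam d r + ell (gamma d) z).
Proof.
  intros Hd Hr HK [Hz Hz2] Ha rh e.
  pose proof (flux_positive d Hd) as Hk. pose proof Hd as (Hg & _).
  assert (Hs : 0 < sqrt (K d r)) by now apply sqrt_lt_R0.
  assert (Hzs : 0 < z * sqrt (K d r)) by now apply Rmult_lt_0_compat.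
  assert (Hrzs : 0 < r * (z * sqrt (K d r))) by now apply Rmult_lt_0_compat.
  assert (Hrh : 0 < rh) by now apply Rdiv_lt_0_compat.
  assert (Hc : 0 < (gamma d - 1) / (2 * gamma d)) by (apply Rdiv_lt_0_compat; lra).
  assert (Hb : 0 < zlim2 (gamma d) - z ^ 2) by lra.
  assert (HKb : 0 < K d r * (zlim2 (gamma d) - z ^ 2)) by now apply Rmult_lt_0_compat.
  assert (He : 0 < e) by now apply Rmult_lt_0_compat.
  assert (HP : 0 < Rpower rh (gamma d)) by apply exp_pos.
  assert (Ls : ln (sqrt (K d r)) = ln (K d r) / 2).
  { rewrite <- (sqrt_sqrt (K d r)) at 2 by lra. rewrite ln_mult by assumption. lra. }
  assert (Lrh : ln rh = ln (- kappa1 d) - ln r - ln z - ln (K d r) / 2).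
  { unfold rh. rewrite ln_div, !ln_mult, Ls by assumption. ring. }
  assert (Le : ln e = ln ((gamma d - 1) / (2 * gamma d)) + ln (K d r)
                      + ln (zlim2 (gamma d) - z ^ 2)).
  { unfold e. rewrite !ln_mult by assumption. ring. }
  transitivity (ln (rh * e) = ln (alpha * Rpower rh (gamma d))).
  - split; [intros ->; reflexivity |].
    intros E. apply ln_inv; [| | exact E]; now apply Rmult_lt_0_compat.
  - rewrite !ln_mult, ln_Rpower, Le, Lrh by assumption.
    unfold entropy_const, lam, ell. split; intros; lra.
Qed.

Lemma polar_flow_state (d : inflow) (z : R -> R) (alpha r : R) :
  physical (gamma d) (z r) -> 0 < alpha ->
  entropy_const d alpha = lam d r + ell (gamma d) (z r) ->
  state d r (polar_flow d z alpha) (z r).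
Proof. intros. now constructor. Qed.

Lemma state_unique (d : inflow) (r z : R) (F G : flow) :
  state d r F z -> state d r G z ->
  U1 F r = U1 G r /\ U2 F r = U2 G r /\ rho F r = rho G r /\
  p F r = p G r /\ A F r = A G r.
Proof.
  intros [] []. repeat split; try congruence.
  apply (entropy_const_inj d); congruence.
Qed.

Lemma state_polytropic (d : inflow) (r z : R) (F : flow) :
  admissible_inflow d -> 0 < r -> 0 < K d r -> state d r F z ->
  0 < rho F r /\ 0 < A F r /\ p F r = A F r * Rpower (rho F r) (gamma d).
Proof.
  intros Hd Hr HK [Hz EU EU2 Erho Ep HA EA].
  split; [| split; [exact HA |]].
  - rewrite Erho. apply Rdiv_lt_0_compat; [now apply flux_positive |].
    destruct Hz as [Hz _].
    repeat apply Rmult_lt_0_compat; try assumption. now apply sqrt_lt_R0.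
  - rewrite Ep, Erho. now apply entropy_relation.
Qed.

Lemma state_integrals (d : inflow) (r z : R) (F : flow) :
  admissible_inflow d -> 0 < r -> 0 < K d r -> state d r F z ->
  r * (rho F r * U1 F r) = kappa1 d /\ r * U2 F r = kappa2 d /\
  bernoulli (gamma d) F r = B0 d.
Proof.
  intros Hd Hr HK [[Hz Hz2] EU EU2 Erho Ep HA EA].
  assert (Hs : 0 < sqrt (K d r)) by now apply sqrt_lt_R0.
  pose proof (flux_positive d Hd) as Hk. pose proof Hd as (Hg & _).
  split; [| split].
  - rewrite Erho, EU. field. lra.
  - rewrite EU2. field. lra.
  - assert (HB : B0 d = (gamma d + 1) / (2 * (gamma d - 1)) * K d r
                        + kappa2 d ^ 2 / (2 * r ^ 2))
      by (rewrite K_bernoulli; lra).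
    rewrite HB. unfold bernoulli. rewrite EU, EU2, Erho, Ep. unfold zlim2.
    replace ((- (z * sqrt (K d r))) ^ 2) with (z ^ 2 * (sqrt (K d r) * sqrt (K d r)))
      by ring.
    rewrite sqrt_sqrt by lra. field. repeat split; lra.
Qed.

(** Conversely the three first integrals and the gas law determine the state up
    to the radial speed; positivity of the pressure is what bounds [z]. *)
Lemma state_of_integrals (d : inflow) (r : R) (F : flow) :
  admissible_inflow d -> 0 < r -> 0 < K d r ->
  0 < rho F r -> 0 < A F r -> p F r = A F r * Rpower (rho F r) (gamma d) ->
  r * (rho F r * U1 F r) = kappa1 d -> r * U2 F r = kappa2 d ->
  bernoulli (gamma d) F r = B0 d ->
  state d r F (- U1 F r / sqrt (K d r)).
Proof.
  intros Hd Hr HK Hrho HA Ep EU EU2 EB.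
  assert (Hs : 0 < sqrt (K d r)) by now apply sqrt_lt_R0.
  pose proof (flux_positive d Hd) as Hk. pose proof Hd as (Hg & _).
  set (z := - U1 F r / sqrt (K d r)).
  assert (EU1 : U1 F r = - (z * sqrt (K d r))) by (unfold z; field; lra).
  assert (EU2' : U2 F r = kappa2 d / r) by (rewrite <- EU2; field; lra).
  assert (Hz : 0 < z).
  { apply Rdiv_lt_0_compat; [| exact Hs].
    apply Rmult_lt_reg_l with (r * rho F r); [now apply Rmult_lt_0_compat |]. lra. }
  assert (Erho : rho F r = - kappa1 d / (r * (z * sqrt (K d r)))).
  { rewrite <- EU, EU1. field. lra. }
  assert (Ep' : p F r = - kappa1 d / (r * (z * sqrt (K d r)))
                        * ((gamma d - 1) / (2 * gamma d)
                           * (K d r * (zlim2 (gamma d) - z ^ 2)))).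
  { rewrite <- Erho.
    assert (E1 : gamma d * p F r / ((gamma d - 1) * rho F r)
                 = K d r * (zlim2 (gamma d) - z ^ 2) / 2).
    { assert (HB : B0 d = (gamma d + 1) / (2 * (gamma d - 1)) * K d r
                          + kappa2 d ^ 2 / (2 * r ^ 2))
        by (rewrite K_bernoulli; lra).
      unfold bernoulli in EB. rewrite HB, EU1, EU2' in EB.
      replace ((- (z * sqrt (K d r))) ^ 2)
        with (z ^ 2 * (sqrt (K d r) * sqrt (K d r))) in EB by ring.
      rewrite sqrt_sqrt in EB by lra.
      apply Rplus_eq_reg_l with (/ 2 * (z ^ 2 * K d r + (kappa2 d / r) ^ 2)).
      rewrite EB. unfold zlim2. field. lra. }
    replace (p F r) with (gamma d * p F r / ((gamma d - 1) * rho F r)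
                          * ((gamma d - 1) * rho F r / gamma d))
      by (field; lra).
    rewrite E1. field. lra. }
  assert (Hp : physical (gamma d) z).
  { split; [exact Hz |].
    assert (Hpp : 0 < p F r)
      by (rewrite Ep; apply Rmult_lt_0_compat; [exact HA | apply exp_pos]).
    rewrite Ep', <- Erho in Hpp. apply Rnot_le_lt. intros Habs.
    apply (Rlt_not_le _ _ Hpp).
    assert (Hc : 0 < (gamma d - 1) / (2 * gamma d)) by (apply Rdiv_lt_0_compat; lra).
    assert (0 <= rho F r * ((gamma d - 1) / (2 * gamma d) * K d r))
      by (left; apply Rmult_lt_0_compat; [| apply Rmult_lt_0_compat]; assumption).
    replace (rho F r * ((gamma d - 1) / (2 * gamma d)
                        * (K d r * (zlim2 (gamma d) - z ^ 2))))
      with (- (rho F r * ((gamma d - 1) / (2 * gamma d) * K d r)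
               * (z ^ 2 - zlim2 (gamma d)))) by ring.
    assert (0 <= rho F r * ((gamma d - 1) / (2 * gamma d) * K d r)
                 * (z ^ 2 - zlim2 (gamma d)))
      by (apply Rmult_le_pos; lra).
    lra. }
  constructor; try assumption.
  apply (entropy_relation d r z (A F r)); try assumption.
  cbv zeta. rewrite <- Ep', <- Erho. exact Ep.
Qed.

(** * Regularity and equations of motion of the radial flows *)

Inductive radial_generator (d : inflow) (z : R -> R) : (R -> R) -> Prop :=
| gen_inv_radius : radial_generator d z (fun r => / r)
| gen_speed : radial_generator d z (fun r => sqrt (K d r))
| gen_inv_speed : radial_generator d z (fun r => / sqrt (K d r))
| gen_ratio : radial_generator d z (fun r => z r)
| gen_inv_ratio : radial_generator d z (fun r => / z r)
| gen_inv_defect : radial_generator d z (fun r => / (1 - z r ^ 2)).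

Ltac polynomial :=
  lazymatch goal with
  | |- polynomial_in _ (fun _ => ?c) => apply poly_const
  | |- polynomial_in ?G (fun x => @?f x + @?g x) => apply (poly_plus G f g); polynomial
  | |- polynomial_in ?G (fun x => @?f x * @?g x) => apply (poly_mult G f g); polynomial
  | |- _ => apply poly_gen; constructor
  end.

(** The solution [z] of lam r + ell (z r) = const satisfies this equation. *)
Definition ratio_equation (d : inflow) (z : R -> R) (r : R) : Prop :=
  is_derive z r (- dlam d r * dbranch (gamma d) (z r)).

Lemma speed_derive (d : inflow) (r : R) : 1 < gamma d -> 0 < r -> 0 < K d r ->
  is_derive (fun t => sqrt (K d t)) r
    ((gamma d - 1) / (gamma d + 1) * kappa2 d ^ 2 / (r ^ 3 * sqrt (K d r))).
Proof.
  intros Hg Hr HK. assert (Hs : 0 < sqrt (K d r)) by now apply sqrt_lt_R0.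
  evar_last.
  - apply is_derive_sqrt; [| exact HK]. apply K_derive; lra.
  - field. lra.
Qed.

Lemma radial_generators_closed (d : inflow) (z : R -> R) (D : R -> Prop) :
  1 < gamma d ->
  (forall r, D r -> 0 < r /\ 0 < K d r /\ physical (gamma d) (z r) /\ z r <> 1 /\
                    ratio_equation d z r) ->
  differentially_closed (radial_generator d z) D.
Proof.
  intros Hg HD.
  set (c := (gamma d - 1) / (gamma d + 1) * kappa2 d ^ 2).
  pose (zd r := -1 * ((gamma d - 1) * kappa2 d ^ 2
                       * (/ r * (/ r * / r) * (/ sqrt (K d r) * / sqrt (K d r)))
                     + (gamma d - 1) * / r)
                * (z r * (zlim2 (gamma d) + -1 * (z r * z r)) * / (gamma d + 1)
                   * / (1 - z r ^ 2))).
  assert (Pzd : polynomial_in (radial_generator d z) zd) by (unfold zd; polynomial).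
  assert (Hzd : forall r, D r -> is_derive z r (zd r)).
  { intros r Hr. destruct (HD r Hr) as (Hr0 & HK & [Hz Hz2] & Hz1 & Hde).
    assert (Hs : 0 < sqrt (K d r)) by now apply sqrt_lt_R0.
    evar_last; [exact Hde |]. unfold zd, dlam, dbranch.
    rewrite <- (sqrt_sqrt (K d r)) at 1 by lra. field.
    repeat split; try lra.
    replace (1 - z r ^ 2) with ((1 - z r) * (1 + z r)) by ring.
    apply Rmult_integral_contrapositive_currified; lra. }
  intros g Hgen; destruct Hgen.
  - exists (fun r => -1 * (/ r * / r)). split; [polynomial |].
    intros r Hr. destruct (HD r Hr) as (Hr0 & _). auto_derive; [lra |]. field. lra.
  - exists (fun r => c * (/ r * (/ r * / r) * / sqrt (K d r))). split; [polynomial |].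
    intros r Hr. destruct (HD r Hr) as (Hr0 & HK & _).
    assert (Hs : 0 < sqrt (K d r)) by now apply sqrt_lt_R0.
    evar_last; [now apply speed_derive |]. unfold c. field. lra.
  - exists (fun r => -1 * (c * (/ r * (/ r * / r) * / sqrt (K d r)))
                     * (/ sqrt (K d r) * / sqrt (K d r))).
    split; [polynomial |].
    intros r Hr. destruct (HD r Hr) as (Hr0 & HK & _).
    assert (Hs : 0 < sqrt (K d r)) by now apply sqrt_lt_R0.
    evar_last; [apply is_derive_inv; [now apply speed_derive | lra] |].
    unfold c. field. lra.
  - exists zd. split; [exact Pzd | exact Hzd].
  - exists (fun r => zd r * (-1 * (/ z r * / z r))). split.
    + apply (poly_mult _ zd); [exact Pzd | polynomial].
    + intros r Hr. destruct (HD r Hr) as (Hr0 & HK & [Hz Hz2] & _).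
      evar_last; [apply is_derive_inv; [now apply Hzd | lra] |]. field. lra.
  - exists (fun r => zd r * (2 * z r * (/ (1 - z r ^ 2) * / (1 - z r ^ 2)))). split.
    + apply (poly_mult _ zd); [exact Pzd | polynomial].
    + intros r Hr. destruct (HD r Hr) as (Hr0 & HK & [Hz Hz2] & Hz1 & _).
      assert (Hne : 1 - z r ^ 2 <> 0).
      { replace (1 - z r ^ 2) with ((1 - z r) * (1 + z r)) by ring.
        apply Rmult_integral_contrapositive_currified; lra. }
      evar_last.
      * apply (is_derive_inv (fun t => 1 - z t ^ 2)); [| exact Hne].
        apply @is_derive_minus; [apply @is_derive_const |].
        apply is_derive_pow. now apply Hzd.
      * unfold minus, plus, opp, zero; simpl. field.
        intros E. apply Hne. rewrite <- E. ring.
Qed.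

Lemma polar_flow_smooth (d : inflow) (z : R -> R) (alpha : R) (D : R -> Prop) :
  1 < gamma d -> open D ->
  (forall r, D r -> 0 < r /\ 0 < K d r /\ physical (gamma d) (z r) /\ z r <> 1 /\
                    ratio_equation d z r) ->
  smooth_flow_on D (polar_flow d z alpha).
Proof.
  intros Hg HDo HD.
  assert (S : forall f g, polynomial_in (radial_generator d z) f ->
                (forall r, D r -> f r = g r) -> smooth_on D g).
  { intros f g Hf Hfg. apply smooth_on_ext with f; [exact HDo | exact Hfg |].
    apply (polynomial_smooth (radial_generator d z)); [exact HDo | | exact Hf].
    now apply radial_generators_closed. }
  assert (Hs : forall r, D r -> 0 < r /\ 0 < z r /\ 0 < sqrt (K d r) /\
                  sqrt (K d r) * sqrt (K d r) = K d r).
  { intros r Hr. destruct (HD r Hr) as (Hr0 & HK & [Hz _] & _).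
    repeat split; try assumption; [now apply sqrt_lt_R0 | apply sqrt_sqrt; lra]. }
  split; [| split; [| split; [| split]]]; simpl.
  - apply (S (fun r => -1 * (z r * sqrt (K d r)))); [polynomial |].
    intros r _. ring.
  - apply (S (fun r => kappa2 d * / r)); [polynomial | reflexivity].
  - apply (S (fun r => - kappa1 d * (/ r * (/ z r * / sqrt (K d r)))));
      [polynomial |].
    intros r Hr. destruct (Hs r Hr) as (? & ? & ? & _). field. lra.
  - apply (S (fun r => - kappa1 d * (/ r * (/ z r * / sqrt (K d r)))
                       * ((gamma d - 1) * / (2 * gamma d)
                          * (sqrt (K d r) * sqrt (K d r)
                             * (zlim2 (gamma d) + -1 * (z r * z r))))));
      [polynomial |].
    intros r Hr. destruct (Hs r Hr) as (? & ? & ? & E). rewrite E. field. lra.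
  - apply (S (fun _ => alpha)); [polynomial | reflexivity].
Qed.

(** Mass, angular momentum and entropy equations are immediate; the radial
    momentum equation is equivalent to [ratio_equation]. *)
Lemma polar_flow_euler (d : inflow) (z : R -> R) (alpha r : R) :
  1 < gamma d -> 0 < r -> 0 < K d r -> physical (gamma d) (z r) -> z r <> 1 ->
  0 < - kappa1 d -> locally r (fun t => 0 < t /\ 0 < K d t /\ 0 < z t) ->
  ratio_equation d z r -> steady_euler_at (polar_flow d z alpha) r.
Proof.
  intros Hg Hr HK [Hz Hz2] Hz1 Hk Hloc Hde.
  assert (Hs : 0 < sqrt (K d r)) by now apply sqrt_lt_R0.
  assert (Hne : 1 - z r ^ 2 <> 0).
  { replace (1 - z r ^ 2) with ((1 - z r) * (1 + z r)) by ring.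
    apply Rmult_integral_contrapositive_currified; lra. }
  pose proof (speed_derive d r Hg Hr HK) as Ds.
  pose proof (K_derive d r Hg (Rgt_not_eq _ _ Hr)) as DK.
  remember (sqrt (K d r)) as s eqn:Es.
  remember ((gamma d - 1) / (gamma d + 1) * kappa2 d ^ 2 / (r ^ 3 * s)) as ds eqn:Eds.
  unfold ratio_equation in Hde.
  remember (- dlam d r * dbranch (gamma d) (z r)) as dz eqn:Edz.
  rename Hde into Dz.
  assert (DU : is_derive (U1 (polar_flow d z alpha)) r (- (dz * s + z r * ds))).
  { apply @is_derive_opp. rewrite Es.
    now apply (Derive.is_derive_mult z (fun t => sqrt (K d t))). }
  assert (Drho : is_derive (rho (polar_flow d z alpha)) r
                   (kappa1 d * (z r * s + r * (dz * s + z r * ds)) / (r * (z r * s)) ^ 2)).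
  { evar_last.
    - apply is_derive_scal. apply is_derive_inv.
      + apply (Derive.is_derive_mult (fun t => t)); [apply @is_derive_id |].
        apply (Derive.is_derive_mult z (fun t => sqrt (K d t))); [exact Dz | exact Ds].
      + rewrite <- Es. apply Rgt_not_eq. repeat apply Rmult_lt_0_compat; assumption.
    - cbv beta. rewrite <- Es. unfold one; simpl. field. lra. }
  assert (Dp : is_derive (p (polar_flow d z alpha)) r
     (kappa1 d * (z r * s + r * (dz * s + z r * ds)) / (r * (z r * s)) ^ 2
        * ((gamma d - 1) / (2 * gamma d) * (K d r * (zlim2 (gamma d) - z r ^ 2)))
      + - kappa1 d / (r * (z r * s))
        * ((gamma d - 1) / (2 * gamma d)
           * (2 * ((gamma d - 1) / (gamma d + 1)) * kappa2 d ^ 2 / r ^ 3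
                * (zlim2 (gamma d) - z r ^ 2)
              + K d r * (- (2 * dz * z r)))))).
  { assert (Dq : is_derive (fun t => zlim2 (gamma d) - z t ^ 2) r (- (2 * dz * z r))).
    { evar_last.
      - apply @is_derive_minus; [apply @is_derive_const | apply is_derive_pow, Dz].
      - unfold minus, plus, opp, zero; simpl. ring. }
    evar_last.
    - exact (Derive.is_derive_mult (rho (polar_flow d z alpha)) _ r _ _ Drho
               (is_derive_scal _ r ((gamma d - 1) / (2 * gamma d)) _
                  (Derive.is_derive_mult (K d) _ r _ _ DK Dq))).
    - simpl. rewrite <- Es. reflexivity. }
  split; [| split; [| split]].
  - rewrite (is_derive_unique _ _ (kappa1 d * - / r ^ 2)).
    + simpl. rewrite <- Es. field. lra.
    + apply is_derive_ext_loc with (fun t => kappa1 d * / t).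
      * eapply filter_imp; [| exact Hloc]. intros t (Ht & HKt & Hzt). simpl.
        assert (0 < sqrt (K d t)) by now apply sqrt_lt_R0. field. lra.
      * apply is_derive_scal. evar_last; [apply is_derive_inv; [apply @is_derive_id | lra] |].
        unfold one; simpl. field. lra.
  - rewrite (is_derive_unique _ _ _ DU), (is_derive_unique _ _ _ Dp). simpl. rewrite <- Es.
    rewrite Edz, Eds. unfold dlam, dbranch, zlim2.
    assert (HK2 : K d r = s * s) by (rewrite Es; symmetry; apply sqrt_sqrt; lra).
    rewrite HK2. field.
    repeat split; try lra.
  - rewrite (is_derive_unique _ _ (kappa2 d * - / r ^ 2)).
    + simpl. rewrite <- Es. field. lra.
    + apply is_derive_scal. evar_last; [apply is_derive_inv; [apply @is_derive_id | lra] |].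
      unfold one; simpl. field. lra.
  - simpl. rewrite Derive_const. ring.
Qed.

Lemma polar_flow_continuous (d : inflow) (z : R -> R) (alpha : R) (D : R -> Prop) :
  1 < gamma d ->
  (forall r, D r -> 0 < r /\ 0 < K d r /\ 0 < z r /\ continuous z r) ->
  continuous_flow_on D (polar_flow d z alpha).
Proof.
  intros Hg HD.
  assert (Cs : forall r, D r -> continuous (fun t => sqrt (K d t)) r).
  { intros r Hr. destruct (HD r Hr) as (Hr0 & HK & _). apply @ex_derive_continuous.
    eexists. now apply speed_derive. }
  assert (CU : forall r, D r -> continuous (fun t => z t * sqrt (K d t)) r).
  { intros r Hr. destruct (HD r Hr) as (Hr0 & HK & Hz & Hc).
    apply @continuous_mult; [exact Hc | now apply Cs]. }
  assert (Crho : forall r, D r -> continuous (rho (polar_flow d z alpha)) r).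
  { intros r Hr. destruct (HD r Hr) as (Hr0 & HK & Hz & Hc).
    assert (Hs : 0 < sqrt (K d r)) by now apply sqrt_lt_R0.
    apply @continuous_mult; [apply continuous_const |].
    apply continuous_Rinv_comp.
    - apply @continuous_mult; [apply continuous_id | now apply CU].
    - apply Rgt_not_eq. repeat apply Rmult_lt_0_compat; assumption. }
  split; [| split; [| split; [| split]]]; apply continuous_on_forall; intros r Hr;
    destruct (HD r Hr) as (Hr0 & HK & Hz & Hc).
  - apply @continuous_opp. now apply CU.
  - apply @continuous_mult; [apply continuous_const |]. apply continuous_Rinv. lra.
  - now apply Crho.
  - apply (@continuous_mult _ R_AbsRing (rho (polar_flow d z alpha))); [now apply Crho |].
    apply @continuous_mult; [apply continuous_const |]. apply @continuous_mult.
    + apply @ex_derive_continuous. eexists. apply K_derive; lra.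
    + apply @continuous_minus; [apply continuous_const |].
      apply continuous_ext with (fun t => z t * z t);
        [intros t; change (z t * z t = z t ^ 2); ring |].
      now apply @continuous_mult.
  - apply continuous_const.
Qed.
(** * First integrals of a smooth solution *)

Lemma continuous_on_id (D : R -> Prop) : continuous_on D (fun x : R => x).
Proof. apply continuous_on_forall. intros x _. apply continuous_id. Qed.

Lemma continuous_on_const (D : R -> Prop) (c : R) : continuous_on D (fun _ : R => c).
Proof. apply continuous_on_forall. intros x _. apply continuous_const. Qed.

Lemma continuous_on_plus (D : R -> Prop) (f g : R -> R) :
  continuous_on D f -> continuous_on D g -> continuous_on D (fun x => f x + g x).
Proof.
  intros Hf Hg x Hx. eapply filterlim_comp_2; [now apply Hf | now apply Hg |].
  apply (@filterlim_plus R_AbsRing R_NormedModule).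
Qed.

Lemma continuous_on_mult (D : R -> Prop) (f g : R -> R) :
  continuous_on D f -> continuous_on D g -> continuous_on D (fun x => f x * g x).
Proof.
  intros Hf Hg x Hx. eapply filterlim_comp_2; [now apply Hf | now apply Hg |].
  apply (@filterlim_mult R_AbsRing).
Qed.

Lemma continuous_on_inv (D : R -> Prop) (f : R -> R) :
  continuous_on D f -> (forall x, D x -> f x <> 0) -> continuous_on D (fun x => / f x).
Proof.
  intros Hf H0 x Hx. eapply filterlim_comp; [now apply Hf |].
  apply continuous_Rinv. now apply H0.
Qed.

Lemma smooth_on_derive (D : R -> Prop) (f : R -> R) (r : R) :
  smooth_on D f -> D r -> is_derive f r (Derive f r).
Proof. intros Hf Hr. apply Derive_correct. exact (Hf 1%nat r Hr). Qed.

Lemma polytropic_pressure_derive (g : R) (D : R -> Prop) (F : flow) (r : R) :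
  open D -> D r -> smooth_euler_on g D F -> Derive (A F) r = 0 ->
  Derive (p F) r = g * p F r / rho F r * Derive (rho F) r.
Proof.
  intros HD Hr ((SU & SU2 & Srho & Sp & SA) & Hpoly & _) HA.
  destruct (Hpoly r Hr) as (Hrho & _ & Ep).
  apply is_derive_unique.
  apply is_derive_ext_loc with (fun t => A F t * exp (g * ln (rho F t))).
  { eapply filter_imp; [| exact (HD r Hr)]. intros t Ht.
    destruct (Hpoly t Ht) as (_ & _ & E). symmetry. exact E. }
  evar_last.
  - apply Derive.is_derive_mult; [now apply smooth_on_derive with D |].
    apply (is_derive_comp exp (fun t => g * ln (rho F t))); [apply is_derive_exp |].
    apply is_derive_scal. apply (is_derive_comp ln (rho F)).
    + now apply is_derive_ln.
    + now apply smooth_on_derive with D.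
  - rewrite HA, Ep. unfold Rpower, scal; simpl; unfold mult; simpl. field. lra.
Qed.

Lemma mass_flux_constant (g : R) (F : flow) (a b : R) : 0 < a ->
  smooth_euler_on g (fun r => a < r < b) F ->
  continuous_flow_on (fun r => a <= r <= b) F ->
  forall x y, a <= x <= b -> a <= y <= b ->
    x * (rho F x * U1 F x) = y * (rho F y * U1 F y).
Proof.
  intros Ha ((SU & SU2 & Srho & Sp & SA) & _ & HE) (CU & CU2 & Crho & Cp & CA).
  apply (constant_on_interval (fun r => r * (rho F r * U1 F r))).
  - apply continuous_on_mult; [apply continuous_on_id | now apply continuous_on_mult].
  - intros r Hr. destruct (HE r Hr) as (E & _).
    assert (Dm : is_derive (fun s => rho F s * U1 F s) r
                   (Derive (fun s => rho F s * U1 F s) r)).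
    { apply Derive_correct. eexists.
      apply Derive.is_derive_mult; now apply smooth_on_derive with (fun r => a < r < b). }
    evar_last; [apply Derive.is_derive_mult; [apply @is_derive_id | exact Dm] |].
    replace (Derive (fun s => rho F s * U1 F s) r)
      with (- (/ r * (rho F r * U1 F r))) by lra.
    unfold one; simpl. field. lra.
Qed.

(** Where the radial velocity does not vanish, the angular momentum, the entropy
    and the Bernoulli function are transported with the fluid, hence constant. *)
Lemma transported_constants (g : R) (F : flow) (a b : R) : 1 < g -> 0 < a ->
  smooth_euler_on g (fun r => a < r < b) F ->
  continuous_flow_on (fun r => a <= r <= b) F ->
  polytropic_on g (fun r => a <= r <= b) F ->
  (forall r, a <= r <= b -> U1 F r <> 0) ->
  forall x y, a <= x <= b -> a <= y <= b ->
    x * U2 F x = y * U2 F y /\ A F x = A F y /\ bernoulli g F x = bernoulli g F y.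
Proof.
  intros Hg Ha Heul (CU & CU2 & Crho & Cp & CA) Hpoly HU x y Hx Hy.
  pose proof Heul as ((SU & SU2 & Srho & Sp & SA) & _ & HE).
  set (D := fun r => a < r < b) in *.
  assert (DA : forall r, D r -> Derive (A F) r = 0).
  { intros r Hr. destruct (HE r Hr) as (_ & _ & _ & E).
    destruct (Rmult_integral _ _ E) as [E0 | E0]; [| exact E0].
    exfalso. apply (HU r); [unfold D in Hr; lra | exact E0]. }
  assert (DU2 : forall r, D r -> Derive (U2 F) r = - U2 F r / r).
  { intros r Hr. destruct (HE r Hr) as (_ & _ & E & _). unfold D in Hr.
    assert (HUr : U1 F r <> 0) by (apply HU; lra).
    apply Rmult_eq_reg_l with (U1 F r); [| exact HUr].
    replace (U1 F r * (- U2 F r / r)) with (- (U1 F r * U2 F r / r)) by (field; lra).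
    lra. }
  split; [| split].
  - apply (constant_on_interval (fun r => r * U2 F r) a b); try assumption.
    + now apply continuous_on_mult; [apply continuous_on_id |].
    + intros r Hr.
      evar_last; [apply Derive.is_derive_mult;
                  [apply @is_derive_id | now apply smooth_on_derive with D] |].
      rewrite DU2 by exact Hr. unfold one; simpl. field. lra.
  - apply (constant_on_interval (A F) a b); try assumption.
    intros r Hr. rewrite <- (DA r Hr). now apply smooth_on_derive with D.
  - apply (constant_on_interval (bernoulli g F) a b); try assumption.
    + apply continuous_on_ext with
        (fun r => / 2 * (U1 F r * U1 F r + U2 F r * U2 F r)
                  + g * (p F r * / ((g - 1) * rho F r))).
      * intros r _. unfold bernoulli, Rdiv.
        match goal with |- ?u = ?v => change (@eq R u v) end. ring.
      * apply continuous_on_plus; (apply continuous_on_mult; [apply continuous_on_const |]).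
        -- apply continuous_on_plus; now apply continuous_on_mult.
        -- apply continuous_on_mult; [exact Cp |]. apply continuous_on_inv.
           ++ now apply continuous_on_mult; [apply continuous_on_const |].
           ++ intros r Hr. destruct (Hpoly r Hr) as (Hrho & _).
              apply Rgt_not_eq, Rmult_lt_0_compat; lra.
    + intros r Hr. destruct (HE r Hr) as (_ & E & _).
      assert (Hr' : a <= r <= b) by lra.
      destruct (Hpoly r Hr') as (Hrho & _).
      pose proof (polytropic_pressure_derive g D F r (open_interval a b) Hr Heul
                    (DA r Hr)) as Ep.
      evar_last.
      * apply @is_derive_plus.
        -- apply is_derive_scal. apply @is_derive_plus;
             apply is_derive_pow; now apply smooth_on_derive with D.
        -- apply is_derive_div.
           ++ apply is_derive_scal. now apply smooth_on_derive with D.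
           ++ apply is_derive_scal. now apply smooth_on_derive with D.
           ++ apply Rgt_not_eq, Rmult_lt_0_compat; lra.
      * unfold plus; simpl. rewrite DU2 by exact Hr.
        assert (E' : U1 F r * Derive (U1 F) r
                     = U2 F r ^ 2 / r - / rho F r * Derive (p F) r) by lra.
        transitivity (U1 F r * Derive (U1 F) r - U2 F r ^ 2 / r
          + g * (rho F r * Derive (p F) r - p F r * Derive (rho F) r)
            / ((g - 1) * rho F r ^ 2)); [field; lra |].
        rewrite E', Ep. field. lra.
Qed.

(** * Structure of an arbitrary solution *)

Definition ratio (d : inflow) (F : flow) (r : R) : R := - U1 F r / sqrt (K d r).

Lemma ratio_state (d : inflow) (F : flow) (r z : R) :
  0 < K d r -> state d r F z -> ratio d F r = z.
Proof.
  intros HK S. unfold ratio. rewrite (state_U1 _ _ _ _ S).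
  assert (0 < sqrt (K d r)) by now apply sqrt_lt_R0. field. lra.
Qed.

Lemma ratio_continuous (d : inflow) (F : flow) (a b : R) :
  admissible_inflow d -> 0 < a -> 0 < K d a ->
  continuous_flow_on (fun r => a <= r <= b) F ->
  continuous_on (fun r => a <= r <= b) (ratio d F).
Proof.
  intros Hd Ha HK (CU & _).
  apply continuous_on_ext with (fun r => -1 * (U1 F r * / sqrt (K d r))).
  { intros r _. unfold ratio, Rdiv.
    match goal with |- ?u = ?v => change (@eq R u v) end. ring. }
  apply continuous_on_mult; [apply continuous_on_const |].
  apply continuous_on_mult; [exact CU |].
  assert (HKr : forall r, a <= r <= b -> 0 < K d r)
    by (intros r Hr; apply (K_positive d a); lra || assumption).
  apply continuous_on_inv.
  - apply continuous_on_forall. intros r Hr. apply @ex_derive_continuous. eexists.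
    apply speed_derive; [apply Hd | lra | now apply HKr].
  - intros r Hr. apply Rgt_not_eq, sqrt_lt_R0. now apply HKr.
Qed.

(** The first integrals carry the constants of the inflow from one radius to the
    whole interval; used from the entrance and, behind the shock, from [rb]. *)
Lemma solution_states (d : inflow) (F : flow) (a b c : R) :
  admissible_inflow d -> 0 < a -> 0 < K d a -> a <= c <= b ->
  smooth_euler_on (gamma d) (fun r => a < r < b) F ->
  continuous_flow_on (fun r => a <= r <= b) F ->
  polytropic_on (gamma d) (fun r => a <= r <= b) F ->
  c * (rho F c * U1 F c) = kappa1 d -> c * U2 F c = kappa2 d ->
  bernoulli (gamma d) F c = B0 d ->
  forall r, a <= r <= b -> state d r F (ratio d F r) /\ A F r = A F c.
Proof.
  intros Hd Ha HK Hc Heul Hcont Hpoly E1 E2 E3 r Hr.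
  pose proof (flux_positive d Hd) as Hk.
  assert (M : forall x, a <= x <= b -> x * (rho F x * U1 F x) = kappa1 d).
  { intros x Hx. rewrite <- E1. now apply (mass_flux_constant (gamma d) F a b). }
  assert (HU : forall x, a <= x <= b -> U1 F x <> 0).
  { intros x Hx E. specialize (M x Hx). rewrite E in M. lra. }
  assert (Hg : 1 < gamma d) by apply Hd.
  destruct (transported_constants (gamma d) F a b Hg Ha Heul Hcont Hpoly HU r c Hr Hc)
    as (T1 & T2 & T3).
  split; [| exact T2].
  destruct (Hpoly r Hr) as (P1 & P2 & P3).
  apply state_of_integrals; try assumption; try lra.
  - apply (K_positive d a); lra || assumption.
  - now apply M.
Qed.

Lemma entrance_state (d : inflow) (F : flow) :
  admissible_inflow d -> 0 < K d (r1 d) -> entrance_condition d F ->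
  p F (r1 d) = A F (r1 d) * Rpower (rho F (r1 d)) (gamma d) ->
  r1 d * (rho F (r1 d) * U1 F (r1 d)) = kappa1 d /\ r1 d * U2 F (r1 d) = kappa2 d /\
  bernoulli (gamma d) F (r1 d) = B0 d /\
  state d (r1 d) F (ratio d F (r1 d)) /\ 1 < ratio d F (r1 d).
Proof.
  intros Hd HK (Erho & EU & EU2 & EA) Ep.
  pose proof Hd as (Hg & H0 & H1 & Hrho & HA & HU & HU2 & Hsup).
  assert (E1 : r1 d * (rho F (r1 d) * U1 F (r1 d)) = kappa1 d)
    by (rewrite Erho, EU; unfold kappa1; ring).
  assert (E2 : r1 d * U2 F (r1 d) = kappa2 d) by (rewrite EU2; reflexivity).
  assert (Epow : Rpower (rho_in d) (gamma d)
                 = rho_in d * Rpower (rho_in d) (gamma d - 1)).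
  { rewrite <- (Rpower_1 (rho_in d)) at 2 by assumption.
    rewrite <- Rpower_plus. f_equal. ring. }
  assert (E3 : bernoulli (gamma d) F (r1 d) = B0 d).
  { unfold bernoulli, B0. rewrite Ep, Erho, EU, EU2, EA, Epow. field. lra. }
  assert (S : state d (r1 d) F (ratio d F (r1 d))).
  { apply state_of_integrals; lra || assumption. }
  repeat (split; [assumption |]).
  pose proof S as [[Hz Hz2] SU _ Srho Sp _ _].
  set (z := ratio d F (r1 d)) in *. rewrite <- Srho in Sp.
  rewrite Ep, Erho, EA, Epow in Sp. rewrite EU in SU. rewrite SU in Hsup.
  assert (Ec : A_in d * Rpower (rho_in d) (gamma d - 1)
               = (gamma d - 1) / (2 * gamma d) * (K d (r1 d) * (zlim2 (gamma d) - z ^ 2))).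
  { apply Rmult_eq_reg_l with (rho_in d); [| lra]. rewrite <- Sp. ring. }
  assert (Hs : (- (z * sqrt (K d (r1 d)))) ^ 2 = z ^ 2 * K d (r1 d)).
  { replace ((- (z * sqrt (K d (r1 d)))) ^ 2)
      with (z ^ 2 * (sqrt (K d (r1 d)) * sqrt (K d (r1 d)))) by ring.
    rewrite sqrt_sqrt; lra. }
  rewrite Rmult_assoc, Ec, Hs in Hsup.
  assert (Hz1 : (gamma d + 1) / 2 * (z ^ 2 - 1) * K d (r1 d) > 0).
  { replace ((gamma d + 1) / 2 * (z ^ 2 - 1) * K d (r1 d))
      with (z ^ 2 * K d (r1 d) - gamma d * ((gamma d - 1) / (2 * gamma d)
              * (K d (r1 d) * (zlim2 (gamma d) - z ^ 2))))
      by (unfold zlim2; field; lra). lra. }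
  apply Rnot_le_lt. intros Hle.
  assert (0 <= (gamma d + 1) / 2 * (1 - z ^ 2) * K d (r1 d)).
  { apply Rmult_le_pos; [apply Rmult_le_pos |]; nra. }
  nra.
Qed.

Definition C_in (d : inflow) : R := entropy_const d (A_in d).

Definition zup (d : inflow) (r : R) : R := zsup (gamma d) (C_in d - lam d r).

(** A flow with constant entropy on [a, b] can be radially sonic only at the
    inner end, because [lam] increases while [ell] is largest at 1. *)
Lemma sonic_only_at_inner_end (d : inflow) (a b c : R) (z : R -> R) :
  admissible_inflow d -> 0 < a -> 0 < K d a ->
  (forall r, a <= r <= b ->
     physical (gamma d) (z r) /\ c = lam d r + ell (gamma d) (z r)) ->
  forall r, a < r <= b -> z r <> 1.
Proof.
  intros Hd Ha HK Hz r Hr E.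
  destruct (Hz a) as [Pa Ea]; [lra |]. destruct (Hz r) as [_ Er]; [lra |].
  rewrite E in Er.
  assert (lam d a < lam d r) by (apply lam_increasing; lra || assumption).
  assert (ell (gamma d) (z a) <= ell (gamma d) 1) by (apply ell_le_max; [apply Hd | exact Pa]).
  lra.
Qed.

Lemma upstream_states (d : inflow) (F : flow) (a b : R) :
  admissible_inflow d -> 0 < a -> 0 < K d a -> a <= r1 d <= b ->
  smooth_euler_on (gamma d) (fun r => a < r < b) F ->
  continuous_flow_on (fun r => a <= r <= b) F ->
  polytropic_on (gamma d) (fun r => a <= r <= b) F ->
  entrance_condition d F ->
  forall r, a <= r <= b -> state d r F (ratio d F r) /\ A F r = A_in d.
Proof.
  intros Hd Ha HK H1 Heul Hcont Hpoly Hent.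
  destruct (Hpoly (r1 d) H1) as (_ & _ & Ep).
  assert (HK1 : 0 < K d (r1 d)) by (apply (K_positive d a); lra || assumption).
  destruct (entrance_state d F Hd HK1 Hent Ep) as (E1 & E2 & E3 & _).
  intros r Hr. replace (A_in d) with (A F (r1 d)) by apply Hent.
  apply (solution_states d F a b (r1 d)); assumption.
Qed.

Lemma upstream_branch (d : inflow) (F : flow) (a b : R) :
  admissible_inflow d -> 0 < a -> 0 < K d a -> a <= r1 d <= b ->
  smooth_euler_on (gamma d) (fun r => a < r < b) F ->
  continuous_flow_on (fun r => a <= r <= b) F ->
  polytropic_on (gamma d) (fun r => a <= r <= b) F ->
  entrance_condition d F -> ratio d F a <> 1 ->
  forall r, a <= r <= b ->
    C_in d - lam d r < ell (gamma d) 1 /\ state d r F (zup d r).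
Proof.
  intros Hd Ha HK H1 Heul Hcont Hpoly Hent Hne.
  pose proof (upstream_states d F a b Hd Ha HK H1 Heul Hcont Hpoly Hent) as S.
  pose proof (ratio_continuous d F a b Hd Ha HK Hcont) as Cz.
  assert (Hg : 1 < gamma d) by apply Hd.
  assert (Z : forall r, a <= r <= b -> physical (gamma d) (ratio d F r) /\
                C_in d = lam d r + ell (gamma d) (ratio d F r)).
  { intros r Hr. destruct (S r Hr) as [Sr EA]. split; [apply Sr |].
    rewrite <- (state_entropy _ _ _ _ Sr), EA. reflexivity. }
  assert (N : forall r, a <= r <= b -> ratio d F r <> 1).
  { intros r Hr. destruct (Req_dec r a) as [-> | Hra]; [exact Hne |].
    apply (sonic_only_at_inner_end d a b (C_in d)); lra || assumption. }
  destruct (Hpoly (r1 d) H1) as (_ & _ & Ep).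
  assert (HK1 : 0 < K d (r1 d)) by (apply (K_positive d a); lra || assumption).
  destruct (entrance_state d F Hd HK1 Hent Ep) as (_ & _ & _ & _ & Hz1).
  intros r Hr.
  assert (Hz : 1 < ratio d F r).
  { apply Rnot_le_lt. intros Hle. pose proof (N r Hr).
    destruct (Rle_lt_dec r (r1 d)) as [Hrr | Hrr].
    - destruct (crossing_up (ratio d F) r (r1 d) 1) as [x [Hx Ex]]; try lra.
      + apply continuous_on_subset with (2 := Cz). intros x Hx; lra.
      + apply (N x); [lra | exact Ex].
    - destruct (crossing_down (ratio d F) (r1 d) r 1) as [x [Hx Ex]]; try lra.
      + apply continuous_on_subset with (2 := Cz). intros x Hx; lra.
      + apply (N x); [lra | exact Ex]. }
  destruct (Z r Hr) as [Pz Ez].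
  replace (C_in d - lam d r) with (ell (gamma d) (ratio d F r)) by lra.
  split; [apply ell_max; lra || assumption |].
  replace (zup d r) with (ratio d F r); [apply S, Hr |].
  symmetry. apply zsup_unique; [exact Hg | split; [lra | apply Pz] | lra].
Qed.

Lemma downstream_branch (d : inflow) (F : flow) (a b : R) :
  admissible_inflow d -> 0 < a -> 0 < K d a -> a < b ->
  (forall r, a <= r <= b -> state d r F (ratio d F r) /\ A F r = A F b) ->
  continuous_flow_on (fun r => a <= r <= b) F -> ratio d F b < 1 ->
  forall r, a <= r <= b ->
    entropy_const d (A F b) - lam d r <= ell (gamma d) 1 /\
    state d r F (zsub (gamma d) (entropy_const d (A F b) - lam d r)).
Proof.
  intros Hd Ha HK Hab S Hcont Hb.
  pose proof (ratio_continuous d F a b Hd Ha HK Hcont) as Cz.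
  assert (Hg : 1 < gamma d) by apply Hd.
  assert (Z : forall r, a <= r <= b -> physical (gamma d) (ratio d F r) /\
                entropy_const d (A F b) = lam d r + ell (gamma d) (ratio d F r)).
  { intros r Hr. destruct (S r Hr) as [Sr EA]. split; [apply Sr |].
    rewrite <- (state_entropy _ _ _ _ Sr), EA. reflexivity. }
  intros r Hr. destruct (Z r Hr) as [Pz Ez].
  assert (Hz : ratio d F r <= 1).
  { apply Rnot_lt_le. intros Hgt.
    destruct (crossing_down (ratio d F) r b 1) as [x [Hx Ex]]; try lra.
    - apply continuous_on_subset with (2 := Cz). intros x Hx; lra.
    - revert Ex. apply (sonic_only_at_inner_end d a b (entropy_const d (A F b)));
        lra || assumption. }
  replace (entropy_const d (A F b) - lam d r) with (ell (gamma d) (ratio d F r)) by lra.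
  split; [now apply ell_le_max |].
  rewrite (zsub_unique (gamma d) _ (ratio d F r)); [apply S, Hr | exact Hg | | reflexivity].
  split; [apply Pz | exact Hz].
Qed.

(** * The Rankine-Hugoniot conditions in terms of radial states *)

(** Momentum flux of a radial state; it is invariant under z -> 1/z, which is
    the Prandtl relation. *)
Lemma state_momentum (d : inflow) (r z : R) (F : flow) :
  admissible_inflow d -> 0 < r -> 0 < K d r -> state d r F z ->
  rho F r * U1 F r ^ 2 + p F r
  = - kappa1 d * sqrt (K d r) / r * ((gamma d + 1) / (2 * gamma d)) * (z + / z).
Proof.
  intros Hd Hr HK [[Hz Hz2] EU EU2 Erho Ep HA EA].
  assert (Hs : 0 < sqrt (K d r)) by now apply sqrt_lt_R0.
  assert (Hg : 1 < gamma d) by apply Hd.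
  assert (HK2 : K d r = sqrt (K d r) * sqrt (K d r)) by (symmetry; apply sqrt_sqrt; lra).
  rewrite Ep, Erho, EU. unfold zlim2.
  set (s := sqrt (K d r)) in *. clearbody s. rewrite HK2. field. lra.
Qed.

Lemma prandtl (d : inflow) (r zm zp : R) (Fm Fp : flow) :
  admissible_inflow d -> 0 < r -> 0 < K d r -> state d r Fm zm -> state d r Fp zp ->
  rho Fp r * U1 Fp r ^ 2 + p Fp r = rho Fm r * U1 Fm r ^ 2 + p Fm r ->
  zm = zp \/ zm * zp = 1.
Proof.
  intros Hd Hr HK Sm Sp E.
  rewrite (state_momentum d r zp Fp), (state_momentum d r zm Fm) in E by assumption.
  pose proof (proj1 (state_physical _ _ _ _ Sm)) as Hm.
  pose proof (proj1 (state_physical _ _ _ _ Sp)) as Hp.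
  assert (Hs : 0 < sqrt (K d r)) by now apply sqrt_lt_R0.
  assert (Hg : 1 < gamma d) by apply Hd. pose proof (flux_positive d Hd) as Hk.
  apply Rmult_eq_reg_l in E.
  - assert (E' : (zm - zp) * (zm * zp - 1) = 0).
    { replace ((zm - zp) * (zm * zp - 1))
        with (zm * zp * ((zm + / zm) - (zp + / zp))) by (field; lra).
      rewrite E. ring. }
    destruct (Rmult_integral _ _ E'); [left | right]; lra.
  - apply Rgt_not_eq, Rmult_lt_0_compat; [apply Rdiv_lt_0_compat |].
    + now apply Rmult_lt_0_compat.
    + exact Hr.
    + apply Rdiv_lt_0_compat; lra.
Qed.

Definition C_down (d : inflow) (rb : R) : R := C_in d + jump (gamma d) (zup d rb).

Definition zdown (d : inflow) (rb r : R) : R := zsub (gamma d) (C_down d rb - lam d r).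

Definition upflow (d : inflow) : flow := polar_flow d (zup d) (A_in d).

Definition A_down (d : inflow) (rb : R) : R :=
  exp (C_down d rb - (gamma d - 1) * ln (- kappa1 d)
       + ln ((gamma d - 1) / (2 * gamma d))).

Definition downflow (d : inflow) (rb : R) : flow :=
  polar_flow d (zdown d rb) (A_down d rb).

Lemma A_down_entropy (d : inflow) (rb : R) :
  entropy_const d (A_down d rb) = C_down d rb.
Proof. unfold entropy_const, A_down. rewrite ln_exp. ring. Qed.

Definition exit_pressure (d : inflow) (z : R) : R :=
  - kappa1 d / (r0 d * (z * sqrt (K d (r0 d))))
  * ((gamma d - 1) / (2 * gamma d) * (K d (r0 d) * (zlim2 (gamma d) - z ^ 2))).

(** The whole free boundary problem, reduced to the position of the shock: the
    incoming flow is not choked before [rb], the flow behind the shock is not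
    choked before the exit, and the exit pressure is the prescribed one. *)
Definition shock_at (d : inflow) (pex rb : R) : Prop :=
  r0 d < rb < r1 d /\ C_in d - lam d rb < ell (gamma d) 1 /\
  C_down d rb - lam d (r0 d) <= ell (gamma d) 1 /\
  exit_pressure d (zdown d rb (r0 d)) = pex.

Lemma shock_at_of_problem_IV (d : inflow) (pex rb : R) (Fm Fp : flow) :
  admissible_inflow d -> 0 < K d (r0 d) -> problem_IV d pex rb Fm Fp ->
  shock_at d pex rb /\
  flow_agree (fun r => rb <= r <= r1 d) Fm (upflow d) /\
  flow_agree (fun r => r0 d <= r <= rb) Fp (downflow d rb).
Proof.
  intros Hd HK [Hpos Em Ep Cm Cp Gm Gp (J1 & J2 & J3 & J4) Hent Hin Hout].
  assert (Hg : 1 < gamma d) by apply Hd.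
  assert (H0 : 0 < r0 d) by apply Hd.
  assert (HKb : 0 < K d rb) by (apply (K_positive d (r0 d)); lra || assumption).
  assert (Hb0 : 0 < rb) by lra.
  pose proof (flux_positive d Hd) as Hk.
  assert (Sm : forall r, rb <= r <= r1 d ->
            state d r Fm (ratio d Fm r) /\ A Fm r = A_in d)
    by (apply upstream_states; lra || assumption).
  destruct (Sm rb) as [Smb EAm]; [lra |].
  destruct (state_integrals d rb _ Fm Hd Hb0 HKb Smb) as (I1 & I2 & I3).
  assert (Hm : rho Fm rb * U1 Fm rb <> 0).
  { intros E. rewrite E in I1. lra. }
  assert (EU2 : U2 Fp rb = U2 Fm rb).
  { apply Rmult_eq_reg_l with (rho Fm rb * U1 Fm rb); [| exact Hm].
    rewrite <- J3, J1. reflexivity. }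
  assert (Sp : forall r, r0 d <= r <= rb ->
            state d r Fp (ratio d Fp r) /\ A Fp r = A Fp rb)
    by (apply solution_states; rewrite ?J1, ?EU2, ?J4; lra || assumption).
  destruct (Sp rb) as [Spb _]; [lra |].
  pose proof (state_entropy _ _ _ _ Smb) as Lm.
  pose proof (state_entropy _ _ _ _ Spb) as Lp.
  set (zm := ratio d Fm rb) in *. set (zp := ratio d Fp rb) in *.
  assert (Hlt : entropy_const d (A Fm rb) < entropy_const d (A Fp rb)).
  { apply entropy_const_lt; [apply Smb | apply Spb | exact Hent]. }
  destruct (compressive (gamma d) zm zp) as [Hzm Ezp]; try assumption.
  - apply Smb.
  - apply Spb.
  - destruct (prandtl d rb zm zp Fm Fp) as [E | E]; try assumption.
    exfalso. rewrite <- E in Lp. lra.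
  - lra.
  - assert (U : forall r, rb <= r <= r1 d ->
              C_in d - lam d r < ell (gamma d) 1 /\ state d r Fm (zup d r)).
    { apply upstream_branch; lra || (try assumption). fold zm. lra. }
    destruct (U rb) as [Ub SUb]; [lra |].
    assert (Ezm : zup d rb = zm).
    { symmetry. now apply ratio_state. }
    assert (EC : entropy_const d (A Fp rb) = C_down d rb).
    { unfold C_down, jump. rewrite Ezm, <- Ezp, Lp. rewrite EAm in Lm.
      fold (C_in d) in Lm. lra. }
    assert (W : forall r, r0 d <= r <= rb ->
              entropy_const d (A Fp rb) - lam d r <= ell (gamma d) 1 /\
              state d r Fp (zsub (gamma d) (entropy_const d (A Fp rb) - lam d r))).
    { apply downstream_branch; lra || (try assumption). fold zp. rewrite Ezp.
      rewrite <- Rinv_1. apply Rinv_lt_contravar; lra. }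
    rewrite EC in W.
    assert (HAp : 0 < A_down d rb) by apply exp_pos.
    split; [| split].
    + repeat split; try lra.
      * apply W. lra.
      * rewrite <- Hout. destruct (W (r0 d)) as [_ S0]; [lra |].
        rewrite (state_p _ _ _ _ S0). reflexivity.
    + intros r Hr. destruct (U r Hr) as [_ Sr].
      apply (state_unique d r (zup d r)); [exact Sr |].
      destruct (Sm r Hr) as [_ EA].
      apply polar_flow_state; [apply Sr | apply Hd |].
      rewrite <- EA. apply Sr.
    + intros r Hr. destruct (W r Hr) as [_ Sr].
      apply (state_unique d r (zdown d rb r)); [exact Sr |].
      apply polar_flow_state; [apply Sr | exact HAp |].
      rewrite A_down_entropy, <- EC. destruct (Sp r Hr) as [_ EA].
      rewrite <- EA. apply Sr.
Qed.
(** * Construction of the solution from the position of the shock *)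

Lemma polar_flow_solution (d : inflow) (z : R -> R) (alpha a b : R) :
  admissible_inflow d -> 0 < a -> 0 < K d a -> 0 < alpha ->
  (forall r, a < r < b -> physical (gamma d) (z r) /\ z r <> 1 /\
     ratio_equation d z r /\ entropy_const d alpha = lam d r + ell (gamma d) (z r)) ->
  smooth_euler_on (gamma d) (fun r => a < r < b) (polar_flow d z alpha).
Proof.
  intros Hd Ha HK Halpha Hz. assert (Hg : 1 < gamma d) by apply Hd.
  assert (HKr : forall r, a < r < b -> 0 < K d r)
    by (intros r Hr; apply (K_positive d a); lra || assumption).
  split; [| split].
  - apply polar_flow_smooth; [exact Hg | apply open_interval |].
    intros r Hr. destruct (Hz r Hr) as (H1 & H2 & H3 & _).
    split; [lra |]. split; [now apply HKr |]. now split; [| split].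
  - intros r Hr. destruct (Hz r Hr) as (H1 & _ & _ & H4).
    apply (state_polytropic d r (z r)); [exact Hd | lra | now apply HKr |].
    now apply polar_flow_state.
  - intros r Hr. destruct (Hz r Hr) as (H1 & H2 & H3 & _).
    apply polar_flow_euler; try assumption; [lra | now apply HKr | | ].
    + now apply flux_positive.
    + eapply filter_imp; [| exact (open_interval a b r Hr)].
      intros t Ht. destruct (Hz t Ht) as ((Hzt & _) & _).
      repeat split; [lra | now apply HKr | exact Hzt].
Qed.

Lemma branch_ratio_equation (d : inflow) (b : R -> R) (c r : R) :
  1 < gamma d -> 0 < r -> 0 < K d r ->
  is_derive b (c - lam d r) (dbranch (gamma d) (b (c - lam d r))) ->
  ratio_equation d (fun t => b (c - lam d t)) r.
Proof.
  intros Hg Hr HK Hb. unfold ratio_equation. evar_last.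
  - apply (is_derive_comp b (fun t => c - lam d t)); [exact Hb |].
    apply @is_derive_minus; [apply @is_derive_const | now apply lam_derive].
  - unfold scal, minus, plus, opp, zero; simpl; unfold mult; simpl. ring.
Qed.

Lemma branch_continuous (d : inflow) (b : R -> R) (c r : R) :
  1 < gamma d -> 0 < r -> 0 < K d r -> continuous b (c - lam d r) ->
  continuous (fun t => b (c - lam d t)) r.
Proof.
  intros Hg Hr HK Hb. apply (continuous_comp (fun t => c - lam d t) b); [| exact Hb].
  apply @continuous_minus; [apply continuous_const | now apply lam_continuous].
Qed.

(** The hypothesis M_1 > 1 at the entrance selects the branch z > 1.  The constant
    flow in the proof only carries the inflow data to [entrance_state]. *)
Lemma entrance_branch (d : inflow) :
  admissible_inflow d -> 0 < K d (r1 d) ->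
  C_in d - lam d (r1 d) < ell (gamma d) 1 /\ entrance_condition d (upflow d).
Proof.
  intros Hd HK. assert (Hg : 1 < gamma d) by apply Hd.
  pose (F := Flow (fun _ => U1_in d) (fun _ => U2_in d) (fun _ => rho_in d)
               (fun _ => A_in d * Rpower (rho_in d) (gamma d)) (fun _ => A_in d)).
  destruct (entrance_state d F Hd HK) as (_ & _ & _ & S & Hz);
    [now repeat split | reflexivity |].
  pose proof (state_entropy _ _ _ _ S) as EC. change (A F (r1 d)) with (A_in d) in EC.
  fold (C_in d) in EC. pose proof (state_physical _ _ _ _ S) as Pz.
  set (z := ratio d F (r1 d)) in *.
  replace (C_in d - lam d (r1 d)) with (ell (gamma d) z) by lra.
  split; [apply ell_max; lra || assumption |].
  assert (Ez : zup d (r1 d) = z)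
    by (apply zsup_unique; [exact Hg | split; [lra | apply Pz] | lra]).
  assert (Su : state d (r1 d) (upflow d) z).
  { rewrite <- Ez. apply polar_flow_state; [now rewrite Ez | apply Hd |].
    rewrite Ez. exact EC. }
  destruct (state_unique d (r1 d) z (upflow d) F Su S) as (E1 & E2 & E3 & _ & E5).
  now repeat split.
Qed.

Lemma unchoked_outside (d : inflow) (x y : R) :
  admissible_inflow d -> 0 < x -> 0 < K d x -> x <= y ->
  C_in d - lam d x < ell (gamma d) 1 -> C_in d - lam d y < ell (gamma d) 1.
Proof.
  intros Hd Hx HK [Hxy | <-] H; [| exact H].
  pose proof (lam_increasing d x y Hd Hx Hxy HK). lra.
Qed.

Lemma zup_spec (d : inflow) (r : R) :
  1 < gamma d -> C_in d - lam d r < ell (gamma d) 1 ->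
  1 < zup d r /\ zup d r ^ 2 < zlim2 (gamma d) /\
  C_in d = lam d r + ell (gamma d) (zup d r).
Proof.
  intros Hg H. unfold zup. split; [now apply zsup_gt_1 |].
  split; [apply zsup_spec, Hg |]. rewrite zsup_ell; lra.
Qed.

Lemma upflow_state (d : inflow) (r : R) :
  admissible_inflow d -> C_in d - lam d r < ell (gamma d) 1 ->
  state d r (upflow d) (zup d r).
Proof.
  intros Hd H. destruct (zup_spec d r) as (H1 & H2 & H3); [apply Hd | exact H |].
  apply polar_flow_state; [split; lra | apply Hd | exact H3].
Qed.

Lemma downflow_state (d : inflow) (rb r : R) :
  admissible_inflow d -> C_down d rb - lam d r <= ell (gamma d) 1 ->
  state d r (downflow d rb) (zdown d rb r).
Proof.
  intros Hd H. assert (Hg : 1 < gamma d) by apply Hd.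
  apply polar_flow_state.
  - apply physical_subcritical; [exact Hg | now apply zsub_spec].
  - apply exp_pos.
  - rewrite A_down_entropy. unfold zdown. rewrite zsub_ell; lra.
Qed.

Lemma zdown_at_shock (d : inflow) (rb : R) :
  1 < gamma d -> C_in d - lam d rb < ell (gamma d) 1 -> zdown d rb rb = / zup d rb.
Proof.
  intros Hg H. destruct (zup_spec d rb Hg H) as (H1 & H2 & H3).
  apply zsub_unique; [exact Hg | apply inv_subcritical; lra |].
  unfold C_down, jump. lra.
Qed.

Lemma unchoked_downstream (d : inflow) (rb r : R) :
  admissible_inflow d -> 0 < K d (r0 d) -> r0 d < r ->
  C_down d rb - lam d (r0 d) <= ell (gamma d) 1 ->
  C_down d rb - lam d r < ell (gamma d) 1.
Proof.
  intros Hd HK Hr H. assert (H0 : 0 < r0 d) by apply Hd.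
  pose proof (lam_increasing d (r0 d) r Hd H0 Hr HK). lra.
Qed.

Lemma problem_IV_of_shock_at (d : inflow) (pex rb : R) :
  admissible_inflow d -> 0 < K d (r0 d) -> shock_at d pex rb ->
  problem_IV d pex rb (upflow d) (downflow d rb).
Proof.
  intros Hd HK (Hpos & Hup & Hdown & Hex).
  assert (Hg : 1 < gamma d) by apply Hd. assert (H0 : 0 < r0 d) by apply Hd.
  assert (Hb0 : 0 < rb) by lra.
  assert (HKr : forall r, r0 d <= r -> 0 < K d r)
    by (intros r Hr; apply (K_positive d (r0 d)); lra || assumption).
  assert (HKb : 0 < K d rb) by (apply HKr; lra).
  assert (Uu : forall r, rb <= r -> C_in d - lam d r < ell (gamma d) 1)
    by (intros r Hr; apply (unchoked_outside d rb r); assumption).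
  assert (Ud : forall r, r0 d <= r -> C_down d rb - lam d r <= ell (gamma d) 1).
  { intros r [Hr | <-]; [left; now apply unchoked_downstream | exact Hdown]. }
  assert (Su : state d rb (upflow d) (zup d rb)) by (apply upflow_state, Uu; lra || assumption).
  assert (Sd : state d rb (downflow d rb) (zdown d rb rb))
    by (apply downflow_state, Ud; lra || assumption).
  destruct (zup_spec d rb Hg Hup) as (Hz1 & Hz2 & Hz3).
  pose proof (zdown_at_shock d rb Hg Hup) as Ez.
  constructor.
  - exact Hpos.
  - apply polar_flow_solution; try assumption; [apply Hd |]. intros r Hr.
    assert (Hr' : C_in d - lam d r < ell (gamma d) 1) by (apply Uu; lra).
    destruct (zup_spec d r Hg Hr') as (Z1 & Z2 & Z3).
    split; [split; lra |]. split; [lra |]. split; [| exact Z3].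
    apply (branch_ratio_equation d (zsup (gamma d))); [exact Hg | lra | apply HKr; lra |].
    now apply zsup_derive.
  - apply polar_flow_solution; try assumption; [apply exp_pos |]. intros r Hr.
    assert (Hr' : C_down d rb - lam d r < ell (gamma d) 1)
      by (apply unchoked_downstream; lra || assumption).
    assert (Z : state d r (downflow d rb) (zdown d rb r))
      by (apply downflow_state; lra || assumption).
    split; [apply Z |]. split; [| split; [| exact (state_entropy _ _ _ _ Z)]].
    + apply Rlt_not_eq. now apply zsub_lt_1.
    + apply (branch_ratio_equation d (zsub (gamma d)));
        [exact Hg | lra | apply HKr; lra |]. now apply zsub_derive.
  - apply polar_flow_continuous; [exact Hg |]. intros r Hr.
    split; [lra |]. split; [apply HKr; lra |]. split.
    + pose proof (zup_spec d r Hg (Uu r (proj1 Hr))). lra.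
    + apply (branch_continuous d (zsup (gamma d))); [exact Hg | lra | apply HKr; lra |].
      now apply zsup_continuous.
  - apply polar_flow_continuous; [exact Hg |]. intros r Hr.
    split; [lra |]. split; [apply HKr; lra |]. split.
    + now apply zsub_spec.
    + apply (branch_continuous d (zsub (gamma d))); [exact Hg | lra | apply HKr; lra |].
      now apply zsub_continuous.
  - intros r Hr. apply (state_polytropic d r (zup d r)); [exact Hd | lra | apply HKr; lra |].
    apply upflow_state, Uu; lra || assumption.
  - intros r Hr. apply (state_polytropic d r (zdown d rb r));
      [exact Hd | lra | apply HKr; lra |].
    apply downflow_state, Ud; lra || assumption.
  - destruct (state_integrals d rb _ _ Hd Hb0 HKb Su) as (I1 & I2 & I3).
    destruct (state_integrals d rb _ _ Hd Hb0 HKb Sd) as (J1 & J2 & J3).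
    assert (E1 : rho (downflow d rb) rb * U1 (downflow d rb) rb
                 = rho (upflow d) rb * U1 (upflow d) rb)
      by (apply Rmult_eq_reg_l with rb; lra).
    assert (E2 : U2 (downflow d rb) rb = U2 (upflow d) rb) by reflexivity.
    split; [exact E1 |]. split; [| split; [now rewrite E1, E2 | lra]].
    rewrite (state_momentum d rb _ _ Hd Hb0 HKb Su).
    rewrite (state_momentum d rb _ _ Hd Hb0 HKb Sd).
    rewrite Ez, Rinv_inv. ring.
  - apply (entropy_const_lt d); [apply Su | apply Sd |].
    change (A (upflow d) rb) with (A_in d). change (A (downflow d rb) rb) with (A_down d rb).
    rewrite A_down_entropy. fold (C_in d). unfold C_down.
    pose proof (jump_positive (gamma d) (zup d rb) Hg Hz1 Hz2). lra.
  - apply entrance_branch; [exact Hd | apply HKr; lra].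
  - exact Hex.
Qed.

(** * Exit pressure *)

Definition exit_scale (d : inflow) : R :=
  - kappa1 d * sqrt (K d (r0 d)) / r0 d * ((gamma d - 1) / (2 * gamma d)).

Lemma exit_scale_positive (d : inflow) :
  admissible_inflow d -> 0 < K d (r0 d) -> 0 < exit_scale d.
Proof.
  intros Hd HK. pose proof (flux_positive d Hd) as Hk.
  destruct Hd as (Hg & H0 & _).
  assert (Hs : 0 < sqrt (K d (r0 d))) by now apply sqrt_lt_R0.
  unfold exit_scale. apply Rmult_lt_0_compat; apply Rdiv_lt_0_compat; try lra.
  now apply Rmult_lt_0_compat.
Qed.

Lemma exit_pressure_eq (d : inflow) (z : R) :
  admissible_inflow d -> 0 < K d (r0 d) -> 0 < z ->
  exit_pressure d z = exit_scale d * (zlim2 (gamma d) / z - z).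
Proof.
  intros Hd HK Hz. destruct Hd as (Hg & H0 & _).
  assert (Hs : 0 < sqrt (K d (r0 d))) by now apply sqrt_lt_R0.
  assert (HK2 : K d (r0 d) = sqrt (K d (r0 d)) * sqrt (K d (r0 d)))
    by (symmetry; apply sqrt_sqrt; lra).
  unfold exit_pressure, exit_scale.
  set (s := sqrt (K d (r0 d))) in *. clearbody s. rewrite HK2. field. lra.
Qed.

Lemma exit_pressure_decreasing (d : inflow) (x y : R) :
  admissible_inflow d -> 0 < K d (r0 d) -> 0 < x -> x < y ->
  exit_pressure d y < exit_pressure d x.
Proof.
  intros Hd HK Hx Hxy. rewrite !exit_pressure_eq by lra || assumption.
  apply Rmult_lt_compat_l; [now apply exit_scale_positive |].
  assert (Hg : 1 < gamma d) by apply Hd. pose proof (zlim2_gt_1 (gamma d) Hg).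
  assert (/ y < / x) by (apply Rinv_lt_contravar; [apply Rmult_lt_0_compat |]; lra).
  unfold Rdiv. nra.
Qed.

Lemma exit_pressure_positive (d : inflow) (z : R) :
  admissible_inflow d -> 0 < K d (r0 d) -> physical (gamma d) z ->
  0 < exit_pressure d z.
Proof.
  intros Hd HK [Hz Hz2]. rewrite exit_pressure_eq by assumption.
  apply Rmult_lt_0_compat; [now apply exit_scale_positive |].
  replace (zlim2 (gamma d) / z - z) with ((zlim2 (gamma d) - z ^ 2) / z) by (field; lra).
  apply Rdiv_lt_0_compat; lra.
Qed.

Lemma exit_pressure_surjective (d : inflow) (pex : R) :
  admissible_inflow d -> 0 < K d (r0 d) -> 0 < pex ->
  exists z, physical (gamma d) z /\ exit_pressure d z = pex.
Proof.
  intros Hd HK Hp. pose proof (exit_scale_positive d Hd HK) as Hc.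
  assert (Hg : 1 < gamma d) by apply Hd. pose proof (zlim2_gt_1 (gamma d) Hg) as Ha.
  (* The positive root of z^2 + b z - a = 0. *)
  set (b := pex / exit_scale d).
  assert (Hb : 0 < b) by now apply Rdiv_lt_0_compat.
  set (q := sqrt (b ^ 2 + 4 * zlim2 (gamma d))).
  assert (Hq2 : q * q = b ^ 2 + 4 * zlim2 (gamma d)) by (apply sqrt_sqrt; nra).
  assert (Hq : b < q).
  { unfold q. rewrite <- (sqrt_pow2 b) at 1 by lra. apply sqrt_lt_1; nra. }
  set (z := (q - b) / 2).
  assert (Hz : 0 < z) by (unfold z; lra).
  assert (Ez : zlim2 (gamma d) - z ^ 2 = b * z).
  { unfold z. replace (((q - b) / 2) ^ 2) with ((q * q - 2 * q * b + b ^ 2) / 4) by field.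
    rewrite Hq2. field. }
  exists z. split.
  - split; [exact Hz |]. assert (0 < b * z) by now apply Rmult_lt_0_compat. lra.
  - rewrite exit_pressure_eq by assumption.
    replace (zlim2 (gamma d) / z - z) with ((zlim2 (gamma d) - z ^ 2) / z) by (field; lra).
    rewrite Ez. unfold b. field. lra.
Qed.

Lemma B0_positive (d : inflow) : admissible_inflow d -> 0 < B0 d.
Proof.
  intros (Hg & H0 & H1 & Hr & HA & HU & HU2 & _). unfold B0.
  assert (0 < U1_in d ^ 2) by nra. assert (0 < U2_in d ^ 2) by now apply pow2_gt_0.
  assert (0 < gamma d * A_in d / (gamma d - 1) * Rpower (rho_in d) (gamma d - 1)).
  { apply Rmult_lt_0_compat; [apply Rdiv_lt_0_compat; nra | apply exp_pos]. }
  lra.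
Qed.

Definition exit_sound2 (d : inflow) (z : R) : R :=
  (gamma d - 1) / 2 * (K d (r0 d) * (zlim2 (gamma d) - z ^ 2)).

(** Both discriminants of the statement are values of f2 at the density that an
    exit with squared sound speed [y] would have; f2 changes sign at the actual
    exit density, so its sign compares [y] with the actual sound speed. *)
Lemma f2_factor (d : inflow) (z y : R) :
  admissible_inflow d -> 0 < K d (r0 d) -> physical (gamma d) z -> 0 < y ->
  exists m, 0 < m /\
    f2 d (exit_pressure d z) (gamma d * exit_pressure d z / y)
    = m * (y - exit_sound2 d z).
Proof.
  intros Hd HK [Hz Hz2] Hy. pose proof (flux_positive d Hd) as Hk.
  pose proof Hd as (Hg & H0 & _).
  assert (Hs : 0 < sqrt (K d (r0 d))) by now apply sqrt_lt_R0.
  assert (HK2 : K d (r0 d) = sqrt (K d (r0 d)) * sqrt (K d (r0 d)))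
    by (symmetry; apply sqrt_sqrt; lra).
  set (c2 := exit_sound2 d z).
  assert (Hc2 : 0 < c2).
  { unfold c2, exit_sound2. apply Rmult_lt_0_compat; [lra |].
    apply Rmult_lt_0_compat; lra. }
  assert (Ep : gamma d * exit_pressure d z
               = - kappa1 d * c2 / (r0 d * (z * sqrt (K d (r0 d))))).
  { unfold exit_pressure, c2, exit_sound2. field. lra. }
  assert (EH : B0 d - kappa2 d ^ 2 / (2 * r0 d ^ 2)
               = (z ^ 2 * K d (r0 d) + 2 * c2 / (gamma d - 1)) / 2).
  { rewrite <- K_bernoulli by lra. unfold c2, exit_sound2, zlim2. field. lra. }
  set (q2 := z ^ 2 * K d (r0 d)) in *.
  assert (Hq2 : 0 < q2) by (apply Rmult_lt_0_compat; [nra | exact HK]).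
  exists (kappa1 d ^ 2 / (2 * r0 d ^ 2)
          * ((q2 * (y + c2) + 2 * c2 ^ 2 / (gamma d - 1)) / (q2 * y ^ 2))).
  split.
  - apply Rmult_lt_0_compat; apply Rdiv_lt_0_compat; try nra.
    + apply Rplus_lt_0_compat; [apply Rmult_lt_0_compat; lra |].
      apply Rdiv_lt_0_compat; nra.
    + apply Rmult_lt_0_compat; nra.
  - unfold f2. rewrite EH, Ep.
    replace (gamma d * exit_pressure d z / (gamma d - 1))
      with (- kappa1 d * c2 / (r0 d * (z * sqrt (K d (r0 d)))) / (gamma d - 1))
      by (rewrite <- Ep; reflexivity).
    unfold q2. set (s := sqrt (K d (r0 d))) in *. clearbody s c2. rewrite HK2.
    field. lra.
Qed.

Lemma f2_sharpsharp_nonpos (d : inflow) (z : R) :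
  admissible_inflow d -> 0 < K d (r0 d) -> physical (gamma d) z ->
  (f2 d (exit_pressure d z) (rho_sharpsharp d (exit_pressure d z)) <= 0 <-> z <= 1).
Proof.
  intros Hd HK Hz. pose proof Hd as (Hg & _).
  destruct (f2_factor d z (K d (r0 d)) Hd HK Hz HK) as [m [Hm E]].
  unfold rho_sharpsharp. rewrite E.
  assert (Ec : K d (r0 d) - exit_sound2 d z
               = (gamma d - 1) / 2 * K d (r0 d) * (z ^ 2 - 1)).
  { unfold exit_sound2, zlim2. field. lra. }
  rewrite Ec.
  assert (Hq : 0 < m * ((gamma d - 1) / 2 * K d (r0 d)))
    by (repeat apply Rmult_lt_0_compat; lra).
  replace (m * ((gamma d - 1) / 2 * K d (r0 d) * (z ^ 2 - 1)))
    with (m * ((gamma d - 1) / 2 * K d (r0 d)) * (z ^ 2 - 1)) by ring.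
  destruct Hz as [Hz _]. split; intros H.
  - apply Rnot_lt_le. intros Hgt. apply (Rle_not_lt _ _ H).
    apply Rmult_lt_0_compat; nra.
  - assert (0 <= 1 - z ^ 2) by nra. nra.
Qed.
(** * The window of exit pressures *)

(** The entropy relation at the exit turns the entropy behind a shock at [r] into
    this value of [ell]; it must not exceed the maximum [ell 1]. *)
Definition exit_ell (d : inflow) (r : R) : R := C_down d r - lam d (r0 d).

Lemma exit_ell_increasing (d : inflow) (x y : R) :
  admissible_inflow d -> 0 < x -> 0 < K d x -> x < y ->
  C_in d - lam d x < ell (gamma d) 1 -> exit_ell d x < exit_ell d y.
Proof.
  intros Hd Hx HK Hxy H. assert (Hg : 1 < gamma d) by apply Hd.
  pose proof (lam_increasing d x y Hd Hx Hxy HK) as Hl.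
  destruct (zup_spec d x Hg H) as (X1 & _ & _).
  destruct (zup_spec d y Hg) as (_ & Y2 & _); [lra |].
  assert (zup d x < zup d y) by (apply zsup_decreasing; lra).
  assert (jump (gamma d) (zup d x) < jump (gamma d) (zup d y))
    by (apply jump_increasing; lra).
  unfold exit_ell, C_down. lra.
Qed.

Lemma exit_ell_continuous (d : inflow) (r : R) :
  admissible_inflow d -> 0 < r -> 0 < K d r ->
  C_in d - lam d r < ell (gamma d) 1 -> continuous (exit_ell d) r.
Proof.
  intros Hd Hr HK H. assert (Hg : 1 < gamma d) by apply Hd.
  destruct (zup_spec d r Hg H) as (H1 & H2 & _).
  assert (Cz : continuous (zup d) r).
  { apply (branch_continuous d (zsup (gamma d))); try assumption. now apply zsup_continuous. }
  unfold exit_ell, C_down, jump.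
  apply @continuous_minus; [| apply continuous_const].
  apply @continuous_plus; [apply continuous_const |].
  apply @continuous_minus.
  - apply (continuous_comp (fun t => / zup d t) (ell (gamma d))).
    + apply continuous_Rinv_comp; [exact Cz | lra].
    + apply ell_continuous; [exact Hg |]. apply physical_subcritical; [exact Hg |].
      apply inv_subcritical; lra.
  - apply (continuous_comp (zup d) (ell (gamma d))); [exact Cz |].
    apply ell_continuous; [exact Hg | split; lra].
Qed.

Lemma shock_exit (d : inflow) (pex rb : R) :
  admissible_inflow d -> shock_at d pex rb ->
  exists z, 0 < z <= 1 /\ ell (gamma d) z = exit_ell d rb /\ exit_pressure d z = pex.
Proof.
  intros Hd (_ & _ & H1 & H2). assert (Hg : 1 < gamma d) by apply Hd.
  exists (zdown d rb (r0 d)). split; [now apply zsub_spec |].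
  split; [| exact H2]. apply zsub_ell; [exact Hg | exact H1].
Qed.

Lemma shock_at_intro (d : inflow) (z rb : R) :
  admissible_inflow d -> r0 d < rb < r1 d -> C_in d - lam d rb < ell (gamma d) 1 ->
  0 < z <= 1 -> ell (gamma d) z = exit_ell d rb -> shock_at d (exit_pressure d z) rb.
Proof.
  intros Hd Hrb H Hz E. assert (Hg : 1 < gamma d) by apply Hd.
  split; [exact Hrb |]. split; [exact H |]. split.
  - fold (exit_ell d rb). rewrite <- E.
    apply ell_le_max; [| apply physical_subcritical]; assumption.
  - f_equal. apply zsub_unique; [exact Hg | exact Hz | exact E].
Qed.

(** A shock closer to the entrance is stronger, leaves more entropy behind and
    therefore less pressure at the exit. *)
Lemma shock_at_decreasing (d : inflow) (pex pex' rb rb' : R) :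
  admissible_inflow d -> 0 < K d (r0 d) -> shock_at d pex rb -> shock_at d pex' rb' ->
  rb < rb' -> pex' < pex.
Proof.
  intros Hd HK S S' Hlt. assert (H0 : 0 < r0 d) by apply Hd.
  assert (Hg : 1 < gamma d) by apply Hd.
  destruct (shock_exit d pex rb Hd S) as (z & Hz & Ez & <-).
  destruct (shock_exit d pex' rb' Hd S') as (z' & Hz' & Ez' & <-).
  destruct S as (Hrb & H & _).
  apply exit_pressure_decreasing; try assumption; [lra |].
  apply (ell_sub_lt (gamma d)); try assumption. rewrite Ez, Ez'.
  apply exit_ell_increasing; try assumption; [lra |].
  apply (K_positive d (r0 d)); lra || assumption.
Qed.

Lemma shock_at_compare (d : inflow) (pex pex' rb rb' : R) :
  admissible_inflow d -> 0 < K d (r0 d) -> shock_at d pex rb -> shock_at d pex' rb' ->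
  (pex < pex' -> rb' < rb) /\ (pex = pex' -> rb = rb').
Proof.
  intros Hd HK S S'.
  pose proof (shock_at_decreasing d pex pex' rb rb' Hd HK S S') as D1.
  pose proof (shock_at_decreasing d pex' pex rb' rb Hd HK S' S) as D2.
  destruct (Rtotal_order rb rb') as [Hlt | [Heq | Hgt]].
  - specialize (D1 Hlt). lra.
  - subst rb'. destruct S as (_ & _ & _ & E), S' as (_ & _ & _ & E'). lra.
  - specialize (D2 Hgt). lra.
Qed.

(** The entropy increase at a shock only lowers the capacity of the flow: if the
    incoming flow is choked at the exit circle or before, so is any flow behind
    a shock. *)
Lemma no_shock_if_choked (d : inflow) (pex rb : R) :
  admissible_inflow d -> ell (gamma d) 1 <= C_in d - lam d (r0 d) ->
  ~ shock_at d pex rb.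
Proof.
  intros Hd Hch (_ & H & H' & _). assert (Hg : 1 < gamma d) by apply Hd.
  destruct (zup_spec d rb Hg H) as (H1 & H2 & _).
  pose proof (jump_positive (gamma d) (zup d rb) Hg H1 H2).
  unfold C_down in H'. lra.
Qed.

(** Stated for every shock, so that it also makes sense when no shock can stand
    at [r] itself. *)
Definition separates (d : inflow) (r ps : R) : Prop :=
  forall pex rb, shock_at d pex rb ->
    (pex < ps -> r < rb) /\ (ps < pex -> rb < r) /\ (pex = ps -> rb = r).

Lemma separates_at_shock (d : inflow) (r ps : R) :
  admissible_inflow d -> 0 < K d (r0 d) -> shock_at d ps r -> separates d r ps.
Proof.
  intros Hd HK S pex rb S'.
  pose proof (shock_at_compare d pex ps rb r Hd HK S' S) as C1.
  pose proof (shock_at_compare d ps pex r rb Hd HK S S') as C2.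
  tauto.
Qed.

(** If the incoming flow is choked before the exit circle, no shock is possible
    and a window below the choked exit pressure contains no solvable pressure.
    Otherwise the end p0 corresponds to a shock at the exit circle and p1 to a
    shock at the entrance circle, unless a shock at the entrance would choke the flow behind
    it; then p1 is any pressure below the one for which the exit is choked, and
    the sign of f2 at rho_sharpsharp cuts the window. *)
Lemma pressure_window (d : inflow) :
  admissible_inflow d -> 0 < K d (r0 d) ->
  exists p1 p0, 0 < p1 /\ p1 < p0 /\
    (forall pex, solvable_pressure d p1 p0 pex <-> exists rb, shock_at d pex rb) /\
    (forall r, r0 d < r < r1 d -> exists ps, p1 < ps < p0 /\ separates d r ps).
Proof.
  intros Hd HK. pose proof Hd as (Hg & H0 & H1 & _).
  assert (P1 : physical (gamma d) 1) by (apply physical_subcritical; lra).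
  pose proof (exit_pressure_positive d 1 Hd HK P1) as Hp1.
  assert (Hle : forall z, 0 < z <= 1 -> exit_pressure d 1 <= exit_pressure d z).
  { intros z Hz. destruct (Req_dec z 1) as [-> | Hne]; [lra |].
    left. apply exit_pressure_decreasing; lra || assumption. }
  assert (Hsolv : forall pex, 0 < pex ->
            (f2 d pex (rho_sharpsharp d pex) <= 0 <->
             exists z, 0 < z <= 1 /\ exit_pressure d z = pex)).
  { intros pex Hpex. split.
    - intros H. destruct (exit_pressure_surjective d pex Hd HK Hpex) as (z & Hz & E).
      exists z. split; [| exact E]. split; [apply Hz |].
      apply (f2_sharpsharp_nonpos d z Hd HK Hz). now rewrite E.
    - intros (z & Hz & <-). apply f2_sharpsharp_nonpos; try assumption; [| apply Hz].
      now apply physical_subcritical. }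
  destruct (Rle_lt_dec (ell (gamma d) 1) (C_in d - lam d (r0 d))) as [Hch | Hun].
  { exists (exit_pressure d 1 / 2), (exit_pressure d 1).
    split; [lra |]. split; [lra |]. split.
    - intros pex. split.
      + intros (Hpex & Hf & Hw). apply (Hsolv pex Hpex) in Hf.
        destruct Hf as (z & Hz & <-). specialize (Hle z Hz). lra.
      + intros [rb S]. exfalso. now apply (no_shock_if_choked d pex rb).
    - intros r Hr. exists (3 / 4 * exit_pressure d 1). split; [lra |].
      intros pex rb S. exfalso. now apply (no_shock_if_choked d pex rb). }
  assert (HKr : forall r, r0 d <= r -> 0 < K d r)
    by (intros r Hr; apply (K_positive d (r0 d)); lra || assumption).
  assert (Un : forall r, r0 d <= r -> C_in d - lam d r < ell (gamma d) 1)
    by (intros r Hr; apply (unchoked_outside d (r0 d) r); assumption).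
  assert (Vinc : forall x y, r0 d <= x -> x < y -> exit_ell d x < exit_ell d y).
  { intros x y Hx Hxy. apply exit_ell_increasing; try assumption; [lra | |].
    - now apply HKr.
    - now apply Un. }
  assert (Vc : continuous_on (fun r => r0 d <= r <= r1 d) (exit_ell d)).
  { apply continuous_on_forall. intros r Hr.
    apply exit_ell_continuous; [exact Hd | lra | apply HKr; lra | apply Un; lra]. }
  destruct (zup_spec d (r0 d) Hg (Un _ (Rle_refl _))) as (Z1 & Z2 & Z3).
  set (zmin := / zup d (r0 d)).
  assert (Hzmin : 0 < zmin < 1).
  { split; [apply Rinv_0_lt_compat; lra |].
    unfold zmin. rewrite <- Rinv_1. apply Rinv_lt_contravar; lra. }
  assert (Ezmin : ell (gamma d) zmin = exit_ell d (r0 d)).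
  { unfold exit_ell, C_down, jump. fold zmin. lra. }
  assert (Hzmax : exists zmax, zmin < zmax /\ physical (gamma d) zmax /\
            (forall z, 0 < z <= 1 -> (z < zmax <-> ell (gamma d) z < exit_ell d (r1 d))) /\
            (ell (gamma d) 1 < exit_ell d (r1 d) -> 1 < zmax)).
  { destruct (Rle_lt_dec (exit_ell d (r1 d)) (ell (gamma d) 1)) as [H | H].
    - destruct (zsub_spec (gamma d) (exit_ell d (r1 d)) Hg) as [Hz Ez].
      rewrite Rmin_left in Ez by exact H.
      set (zmax := zsub (gamma d) (exit_ell d (r1 d))) in *.
      assert (Hiff : forall z, 0 < z <= 1 ->
                (z < zmax <-> ell (gamma d) z < exit_ell d (r1 d))).
      { intros z Hz'. rewrite <- Ez. split; intros Hlt.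
        - apply ell_increasing; lra.
        - now apply (ell_sub_lt (gamma d)). }
      exists zmax. split; [| split; [| split]].
      + apply Hiff; [lra |]. rewrite Ezmin. apply Vinc; lra.
      + now apply physical_subcritical.
      + exact Hiff.
      + lra.
    - pose proof (zlim2_gt_1 (gamma d) Hg) as Ha.
      (* Any physical value beyond 1 does, since all exits have z <= 1. *)
      set (zmax := sqrt ((1 + zlim2 (gamma d)) / 2)).
      assert (E : zmax ^ 2 = (1 + zlim2 (gamma d)) / 2) by (apply pow2_sqrt; lra).
      assert (H1z : 1 < zmax) by (unfold zmax; rewrite <- sqrt_1 at 1; apply sqrt_lt_1; lra).
      exists zmax. split; [lra |]. split; [split; lra |]. split; [| lra].
      intros z Hz. split; intros _; [| lra].
      assert (ell (gamma d) z <= ell (gamma d) 1)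
        by (apply ell_le_max; [| apply physical_subcritical]; assumption). lra. }
  destruct Hzmax as (zmax & Hmm & Pmax & Hmax & Hmax1).
  exists (exit_pressure d zmax), (exit_pressure d zmin).
  assert (Hwin : forall z, 0 < z -> (exit_pressure d zmax < exit_pressure d z < exit_pressure d zmin
                             <-> zmin < z < zmax)).
  { assert (Hdec : forall x y, 0 < x -> 0 < y ->
              (exit_pressure d y < exit_pressure d x <-> x < y)).
    { intros x y Hx Hy. split.
      - intros H. destruct (Rtotal_order x y) as [E | [-> | E]]; [exact E | lra |].
        pose proof (exit_pressure_decreasing d y x Hd HK Hy E). lra.
      - now apply exit_pressure_decreasing. }
    intros z Hz. rewrite !Hdec by lra. tauto. }
  assert (Hback : forall pex rb, shock_at d pex rb ->
            solvable_pressure d (exit_pressure d zmax) (exit_pressure d zmin) pex).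
  { intros pex rb S. destruct (shock_exit d pex rb Hd S) as (z & Hz & Ez & Ep).
    assert (Pz : physical (gamma d) z) by now apply physical_subcritical.
    assert (Hpex : 0 < pex) by (rewrite <- Ep; now apply exit_pressure_positive).
    destruct S as (Hrb & _).
    split; [exact Hpex |]. split; [apply (Hsolv pex Hpex); now exists z |].
    rewrite <- Ep. apply Hwin; [lra |]. split.
    - apply (ell_sub_lt (gamma d)); try lra. rewrite Ezmin, Ez. apply Vinc; lra.
    - apply Hmax; [exact Hz |]. rewrite Ez. apply Vinc; lra. }
  split; [now apply exit_pressure_positive |].
  split; [apply exit_pressure_decreasing; lra || assumption |]. split.
  - intros pex. split; [| intros [rb S]; now apply Hback with rb].
    intros (Hpex & Hf & Hw). apply (Hsolv pex Hpex) in Hf.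
    destruct Hf as (z & Hz & Ep). rewrite <- Ep in Hw.
    apply Hwin in Hw; [| lra].
    destruct (crossing_up (exit_ell d) (r0 d) (r1 d) (ell (gamma d) z))
      as [rb [Hrb Erb]]; [lra | exact Vc | |].
    + rewrite <- Ezmin. split; [apply ell_increasing; lra |]. apply Hmax; lra.
    + exists rb. rewrite <- Ep. apply shock_at_intro; try assumption.
      * apply Un. lra.
      * now symmetry.
  - intros r Hr. destruct (Rle_lt_dec (exit_ell d r) (ell (gamma d) 1)) as [H | H].
    + destruct (zsub_spec (gamma d) (exit_ell d r) Hg) as [Hz Ez].
      rewrite Rmin_left in Ez by exact H.
      assert (S : shock_at d (exit_pressure d (zsub (gamma d) (exit_ell d r))) r)
        by (apply shock_at_intro; try assumption; apply Un; lra).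
      eexists. split; [exact (proj2 (proj2 (Hback _ r S))) | now apply separates_at_shock].
    + (* A shock at [r] would choke the flow behind it, so every shock is inside. *)
      assert (Hz1 : 1 < zmax).
      { apply Hmax1. pose proof (Vinc r (r1 d)). lra. }
      pose proof (exit_pressure_decreasing d 1 zmax Hd HK Rlt_0_1 Hz1).
      pose proof (exit_pressure_decreasing d zmin 1 Hd HK (proj1 Hzmin) (proj2 Hzmin)).
      exists ((exit_pressure d zmax + exit_pressure d 1) / 2). split; [lra |].
      intros pex rb S. destruct (shock_exit d pex rb Hd S) as (z & Hz & Ez & Ep).
      specialize (Hle z Hz). rewrite Ep in Hle.
      assert (rb < r); [| lra].
      apply Rnot_le_lt. intros Habs. destruct S as (Hrb & _).
      assert (exit_ell d r <= exit_ell d rb).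
      { destruct Habs as [Hlt | ->]; [left; apply Vinc |]; lra. }
      assert (ell (gamma d) z <= ell (gamma d) 1)
        by (apply ell_le_max; [| apply physical_subcritical]; assumption). lra.
Qed.

(** * Sonic classification of the flow *)

(** |U|^2 - c^2, with the speed eliminated by the Bernoulli law. *)
Definition sonic_excess (d : inflow) (r z : R) : R :=
  2 * B0 d - (gamma d + 1) / 2 * (K d r * (zlim2 (gamma d) - z ^ 2)).

Lemma state_sonic_excess (d : inflow) (r z : R) (F : flow) :
  admissible_inflow d -> 0 < r -> 0 < K d r -> state d r F z ->
  speed2 F r - sound2 (gamma d) F r = sonic_excess d r z.
Proof.
  intros Hd Hr HK [[Hz Hz2] EU EU2 Erho Ep HA EA].
  assert (Hs : 0 < sqrt (K d r)) by now apply sqrt_lt_R0.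
  pose proof (flux_positive d Hd) as Hk. pose proof Hd as (Hg & _).
  assert (HB : B0 d = (gamma d + 1) / (2 * (gamma d - 1)) * K d r
                      + kappa2 d ^ 2 / (2 * r ^ 2))
    by (rewrite K_bernoulli; lra).
  unfold speed2, sound2, sonic_excess, zlim2. rewrite EU, EU2, Erho, Ep, HB.
  unfold zlim2.
  replace ((- (z * sqrt (K d r))) ^ 2) with (z ^ 2 * (sqrt (K d r) * sqrt (K d r)))
    by ring.
  rewrite sqrt_sqrt by lra. field. repeat split; lra.
Qed.

(** At a fixed radius, shocks are classified by the sign of this quantity at the
    speed ratio ahead; it is 0 exactly when f1 = 1. *)
Definition shock_margin (d : inflow) (r z : R) : R :=
  (gamma d + 1) * (1 - / z ^ 2) - 2 * (kappa2 d ^ 2 / (r ^ 2 * K d r)).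

Lemma sonic_excess_behind (d : inflow) (r z : R) :
  1 < gamma d -> 0 < r -> 0 < K d r -> 0 < z ->
  sonic_excess d r (/ z) = - (K d r / 2) * shock_margin d r z.
Proof.
  intros Hg Hr HK Hz.
  assert (HB : B0 d = (gamma d + 1) / (2 * (gamma d - 1)) * K d r
                      + kappa2 d ^ 2 / (2 * r ^ 2))
    by (rewrite K_bernoulli; lra).
  unfold sonic_excess, shock_margin, zlim2. rewrite HB. field. lra.
Qed.

Lemma shock_margin_increasing (d : inflow) (x y : R) :
  admissible_inflow d -> 0 < x -> 0 < K d x -> x < y ->
  C_in d - lam d x < ell (gamma d) 1 ->
  shock_margin d x (zup d x) < shock_margin d y (zup d y).
Proof.
  intros Hd Hx HK Hxy H. assert (Hg : 1 < gamma d) by apply Hd.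
  pose proof (lam_increasing d x y Hd Hx Hxy HK) as Hl.
  destruct (zup_spec d x Hg H) as (X1 & _ & _).
  assert (Hz : zup d x < zup d y) by (apply zsup_decreasing; lra).
  pose proof (K_increasing d x y Hd Hx Hxy) as HKK.
  assert (H1 : / zup d y ^ 2 < / zup d x ^ 2).
  { apply Rinv_lt_contravar; [apply Rmult_lt_0_compat |]; nra. }
  assert (H2 : / (y ^ 2 * K d y) < / (x ^ 2 * K d x)).
  { assert (x ^ 2 < y ^ 2) by nra. assert (0 < x ^ 2) by nra.
    apply Rinv_lt_contravar; [repeat apply Rmult_lt_0_compat |]; nra. }
  assert (0 <= kappa2 d ^ 2) by nra.
  unfold shock_margin, Rdiv. nra.
Qed.

Lemma f1_eq_1_margin (d : inflow) (r z : R) (F : flow) :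
  admissible_inflow d -> 0 < r -> 0 < K d r -> state d r F z ->
  f1 d F r = 1 -> shock_margin d r z = 0.
Proof.
  intros Hd Hr HK [[Hz Hz2] EU EU2 Erho Ep HA EA] E.
  assert (Hs : 0 < sqrt (K d r)) by now apply sqrt_lt_R0.
  pose proof (flux_positive d Hd) as Hk. pose proof Hd as (Hg & _).
  assert (EK : (gamma d - 1) * (2 * r ^ 2 * B0 d - kappa2 d ^ 2)
               = (gamma d + 1) * r ^ 2 * K d r)
    by (unfold K; field; lra).
  assert (Hb : 0 < gamma d + 1 - (gamma d - 1) * z ^ 2).
  { replace (gamma d + 1 - (gamma d - 1) * z ^ 2)
      with ((gamma d - 1) * (zlim2 (gamma d) - z ^ 2)) by (unfold zlim2; field; lra).
    apply Rmult_lt_0_compat; lra. }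
  assert (EM : mach1_2 (gamma d) F r
               = 2 * z ^ 2 / (gamma d + 1 - (gamma d - 1) * z ^ 2)).
  { unfold mach1_2, sound2. rewrite EU, Erho, Ep.
    replace ((- (z * sqrt (K d r))) ^ 2) with (z ^ 2 * (sqrt (K d r) * sqrt (K d r)))
      by ring.
    rewrite sqrt_sqrt by lra. unfold zlim2. field.
    repeat split; lra. }
  unfold f1 in E. rewrite EK, EM in E. unfold shock_margin.
  assert (E2 : (1 - kappa2 d ^ 2 / (r ^ 2 * K d r)) * (2 * z ^ 2)
               = gamma d + 1 - (gamma d - 1) * z ^ 2).
  { apply Rmult_eq_reg_r with (/ (gamma d + 1 - (gamma d - 1) * z ^ 2));
      [| apply Rinv_neq_0_compat; lra].
    rewrite Rinv_r by lra. etransitivity; [| exact E]. field. lra. }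
  apply Rmult_eq_reg_r with (z ^ 2); [| nra].
  transitivity ((gamma d + 1) * (z ^ 2 - 1)
                - 2 * (kappa2 d ^ 2 / (r ^ 2 * K d r)) * z ^ 2); [field; nra |].
  lra.
Qed.

(** The maximal incoming flow crosses no radially sonic circle before its end,
    hence follows the supersonic branch down to r'_*. *)
Lemma r_star'_margin (d : inflow) (rs : R) :
  admissible_inflow d -> 0 < K d (r0 d) -> is_r_star' d rs ->
  0 < rs /\ 0 < K d rs /\ C_in d - lam d rs < ell (gamma d) 1 /\
  shock_margin d rs (zup d rs) = 0.
Proof.
  intros Hd HK (a & F & ((Ha & Heul & Hent) & _) & Hars & Hst & Hf1).
  pose proof Hd as (Hg & H0 & H1 & _).
  assert (HK1 : 0 < K d (r1 d)) by (apply (K_positive d (r0 d)); lra || assumption).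
  pose proof (B0_positive d Hd) as HB.
  assert (Hst0 : 0 <= r_star d)
    by (apply Rmult_le_pos; [apply sqrt_pos | apply Rabs_pos]).
  assert (HKst : forall r, r_star d < r -> 0 < K d r).
  { intros r Hr.
    assert (Hsq : r_star d ^ 2 < r ^ 2) by nra.
    assert (Es : r_star d ^ 2 * ((gamma d - 1) * B0 d) = gamma d * kappa2 d ^ 2).
    { unfold r_star. rewrite Rpow_mult_distr, pow2_abs, pow2_sqrt.
      - field. lra.
      - left. apply Rdiv_lt_0_compat; [lra | apply Rmult_lt_0_compat; lra]. }
    assert (HgB : 0 < (gamma d - 1) * B0 d) by (apply Rmult_lt_0_compat; lra).
    assert (Hk2 : kappa2 d ^ 2 < 2 * r ^ 2 * B0 d).
    { apply Rmult_lt_reg_l with (gamma d); [lra |]. rewrite <- Es.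
      apply Rlt_le_trans with (r ^ 2 * ((gamma d - 1) * B0 d)); [nra |].
      assert (0 < r ^ 2 * B0 d) by (apply Rmult_lt_0_compat; nra). nra. }
    replace (K d r) with ((gamma d - 1) / (gamma d + 1)
                          * ((2 * r ^ 2 * B0 d - kappa2 d ^ 2) / r ^ 2))
      by (unfold K; field; lra).
    apply Rmult_lt_0_compat; apply Rdiv_lt_0_compat; nra. }
  assert (Hal : exists al, 0 < al /\ a < al /\ al < rs /\ al < r1 d /\ 0 < K d al).
  { destruct (Rle_lt_dec rs (r1 d)) as [H | H].
    - set (m := Rmax a (r_star d)).
      assert (Hm : a <= m /\ r_star d <= m /\ m < rs)
        by (split; [apply Rmax_l | split; [apply Rmax_r | now apply Rmax_lub_lt]]).
      exists ((m + rs) / 2). repeat split; try lra. apply HKst. lra.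
    - set (m := Rmax a (r0 d)).
      assert (Hm : a <= m /\ r0 d <= m /\ m < r1 d)
        by (split; [apply Rmax_l | split; [apply Rmax_r | apply Rmax_lub_lt; lra]]).
      exists ((m + r1 d) / 2). repeat split; try lra.
      apply (K_positive d (r0 d)); lra || assumption. }
  destruct Hal as (al & Hal0 & Haal & Halrs & Hal1 & HKal).
  set (lo := (al + Rmin rs (r1 d)) / 2). set (hi := Rmax rs (r1 d)).
  assert (Hlo : al < lo < rs /\ lo < r1 d).
  { unfold lo, Rmin. destruct Rle_dec; lra. }
  assert (Hhi : rs <= hi /\ r1 d <= hi) by (split; [apply Rmax_l | apply Rmax_r]).
  assert (Sub : forall b, a < b -> smooth_euler_on (gamma d) (fun r => b < r < hi) F /\
            continuous_flow_on (fun r => b <= r <= hi) F /\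
            polytropic_on (gamma d) (fun r => b <= r <= hi) F).
  { intros b Hb. destruct Heul as ((SU & SU2 & Srho & Sp & SA) & Hpoly & HE).
    assert (SS : forall f, smooth_on (fun r => a < r) f ->
              smooth_on (fun r => b < r < hi) f /\
              continuous_on (fun r => b <= r <= hi) f).
    { intros f Hf. split.
      - intros n r Hr. apply Hf. lra.
      - apply continuous_on_forall. intros r Hr. apply @ex_derive_continuous.
        apply (Hf 1%nat r). lra. }
    split; [split; [| split] |split].
    - repeat split; now apply SS.
    - intros r Hr. apply Hpoly. lra.
    - intros r Hr. apply HE. lra.
    - repeat split; now apply SS.
    - intros r Hr. apply Hpoly. lra. }
  assert (HKlo : 0 < K d lo) by (apply (K_positive d al); lra || assumption).
  assert (Hne : ratio d F lo <> 1).
  { destruct (Sub al Haal) as (S1 & S2 & S3).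
    pose proof (upstream_states d F al hi Hd Hal0 HKal) as U.
    apply (sonic_only_at_inner_end d al hi (C_in d) (ratio d F)); try assumption; try lra.
    intros r Hr. destruct (U ltac:(lra) S1 S2 S3 Hent r Hr) as [Sr EA].
    split; [apply Sr |]. rewrite <- (state_entropy _ _ _ _ Sr), EA. reflexivity. }
  destruct (Sub lo) as (S1 & S2 & S3); [lra |].
  destruct (upstream_branch d F lo hi Hd) with (r := rs) as [Hun Srs];
    try assumption; try lra.
  assert (HKrs : 0 < K d rs) by (apply (K_positive d lo); lra || assumption).
  split; [lra |]. split; [exact HKrs |]. split; [exact Hun |].
  apply (f1_eq_1_margin d rs _ F); try assumption. lra.
Qed.
Definition down_excess (d : inflow) (rb r : R) : R := sonic_excess d r (zdown d rb r).

Lemma downflow_excess (d : inflow) (pex rb r : R) :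
  admissible_inflow d -> 0 < K d (r0 d) -> shock_at d pex rb -> r0 d <= r <= rb ->
  speed2 (downflow d rb) r - sound2 (gamma d) (downflow d rb) r = down_excess d rb r.
Proof.
  intros Hd HK (Hrb & _ & Hdown & _) Hr. assert (H0 : 0 < r0 d) by apply Hd.
  apply state_sonic_excess; [exact Hd | lra | |].
  - apply (K_positive d (r0 d)); lra || assumption.
  - apply downflow_state; [exact Hd |].
    destruct (proj1 Hr) as [Hlt | <-]; [left; now apply unchoked_downstream | exact Hdown].
Qed.

(** Inwards along the flow behind the shock both K and zlim2 - z^2 decrease, so
    the sound speed falls and the total speed rises: the sonic circle is crossed
    at most once. *)
Lemma down_excess_decreasing (d : inflow) (pex rb x y : R) :
  admissible_inflow d -> 0 < K d (r0 d) -> shock_at d pex rb ->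
  r0 d <= x -> x < y -> down_excess d rb y < down_excess d rb x.
Proof.
  intros Hd HK (Hrb & _ & Hdown & _) Hx Hxy.
  assert (H0 : 0 < r0 d) by apply Hd. assert (Hg : 1 < gamma d) by apply Hd.
  assert (HKx : 0 < K d x) by (apply (K_positive d (r0 d)); lra || assumption).
  assert (Hx0 : 0 < x) by lra.
  pose proof (K_increasing d x y Hd Hx0 Hxy) as HKK.
  pose proof (lam_increasing d x y Hd Hx0 Hxy HKx) as Hl.
  assert (Hcx : C_down d rb - lam d x <= ell (gamma d) 1).
  { destruct Hx as [Hlt | <-]; [left; now apply unchoked_downstream | exact Hdown]. }
  assert (Hz : zdown d rb y < zdown d rb x) by (apply zsub_increasing; lra).
  destruct (zsub_spec (gamma d) (C_down d rb - lam d x) Hg) as [Zx _].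
  destruct (zsub_spec (gamma d) (C_down d rb - lam d y) Hg) as [Zy _].
  fold (zdown d rb x) in Zx. fold (zdown d rb y) in Zy.
  pose proof (zlim2_gt_1 (gamma d) Hg) as Ha.
  assert (H1 : zdown d rb y ^ 2 < zdown d rb x ^ 2) by nra.
  assert (H2 : zdown d rb x ^ 2 <= 1) by nra.
  assert (H3 : K d x * (zlim2 (gamma d) - zdown d rb x ^ 2)
               < K d y * (zlim2 (gamma d) - zdown d rb y ^ 2))
    by (apply Rmult_gt_0_lt_compat; lra).
  unfold down_excess, sonic_excess. nra.
Qed.

Lemma down_excess_continuous (d : inflow) (rb : R) :
  admissible_inflow d -> 0 < K d (r0 d) ->
  continuous_on (fun r => r0 d <= r <= rb) (down_excess d rb).
Proof.
  intros Hd HK. assert (H0 : 0 < r0 d) by apply Hd. assert (Hg : 1 < gamma d) by apply Hd.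
  apply continuous_on_forall. intros r Hr.
  assert (HKr : 0 < K d r) by (apply (K_positive d (r0 d)); lra || assumption).
  assert (Cz : continuous (zdown d rb) r).
  { apply (branch_continuous d (zsub (gamma d))); try assumption; [lra |].
    now apply zsub_continuous. }
  unfold down_excess, sonic_excess.
  apply @continuous_minus; [apply continuous_const |].
  apply @continuous_mult; [apply continuous_const |]. apply @continuous_mult.
  - apply @ex_derive_continuous. eexists. apply K_derive; lra.
  - apply @continuous_minus; [apply continuous_const |].
    apply continuous_ext with (fun t => zdown d rb t * zdown d rb t);
      [intros t; change (zdown d rb t * zdown d rb t = zdown d rb t ^ 2); ring |].
    now apply @continuous_mult.
Qed.

Lemma down_excess_at_shock (d : inflow) (pex rb : R) :
  admissible_inflow d -> 0 < K d (r0 d) -> shock_at d pex rb ->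
  0 < K d rb /\ down_excess d rb rb = - (K d rb / 2) * shock_margin d rb (zup d rb).
Proof.
  intros Hd HK (Hrb & Hup & _). assert (H0 : 0 < r0 d) by apply Hd.
  assert (Hg : 1 < gamma d) by apply Hd.
  assert (HKb : 0 < K d rb) by (apply (K_positive d (r0 d)); lra || assumption).
  split; [exact HKb |]. unfold down_excess.
  rewrite zdown_at_shock by assumption.
  destruct (zup_spec d rb Hg Hup) as (H1 & _).
  apply sonic_excess_behind; lra.
Qed.

Lemma f2_sharp_sign (d : inflow) (pex rb : R) :
  admissible_inflow d -> 0 < K d (r0 d) -> shock_at d pex rb ->
  exists m, 0 < m /\ f2 d pex (rho_sharp d pex) = m * down_excess d rb (r0 d).
Proof.
  intros Hd HK (_ & _ & _ & <-). pose proof Hd as (Hg & _).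
  pose proof (B0_positive d Hd) as HB.
  assert (Pz : physical (gamma d) (zdown d rb (r0 d)))
    by (apply physical_subcritical; [exact Hg | now apply zsub_spec]).
  set (z := zdown d rb (r0 d)) in *.
  (* The squared sound speed of a sonic state with Bernoulli constant B0. *)
  set (y := 2 * (gamma d - 1) * B0 d / (gamma d + 1)).
  assert (Hy : 0 < y).
  { apply Rdiv_lt_0_compat; [| lra]. apply Rmult_lt_0_compat; lra. }
  destruct (f2_factor d z y Hd HK Pz Hy) as [m [Hm E]].
  exists (m * ((gamma d - 1) / (gamma d + 1))). split.
  - apply Rmult_lt_0_compat; [exact Hm | apply Rdiv_lt_0_compat; lra].
  - replace (rho_sharp d (exit_pressure d z)) with (gamma d * exit_pressure d z / y)
      by (unfold rho_sharp, y; field; lra).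
    rewrite E. unfold down_excess, sonic_excess, exit_sound2, y. fold z. field. lra.
Qed.

Lemma upflow_supersonic (d : inflow) (pex rb r : R) :
  admissible_inflow d -> 0 < K d (r0 d) -> shock_at d pex rb -> rb <= r <= r1 d ->
  supersonic (gamma d) (upflow d) r.
Proof.
  intros Hd HK (Hrb & Hup & _) Hr.
  assert (H0 : 0 < r0 d) by apply Hd. assert (Hg : 1 < gamma d) by apply Hd.
  assert (HKb : 0 < K d rb) by (apply (K_positive d (r0 d)); lra || assumption).
  assert (HKr : 0 < K d r) by (apply (K_positive d (r0 d)); lra || assumption).
  assert (Hun : C_in d - lam d r < ell (gamma d) 1)
    by (apply (unchoked_outside d rb r); lra || assumption).
  destruct (zup_spec d r Hg Hun) as (Z1 & _).
  assert (Hr0 : 0 < r) by lra.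
  pose proof (state_sonic_excess d r _ _ Hd Hr0 HKr (upflow_state d r Hd Hun)) as E.
  assert (HB : B0 d = (gamma d + 1) / (2 * (gamma d - 1)) * K d r
                      + kappa2 d ^ 2 / (2 * r ^ 2))
    by (rewrite K_bernoulli; lra).
  assert (Es : sonic_excess d r (zup d r)
               = (gamma d + 1) / 2 * K d r * (zup d r ^ 2 - 1) + kappa2 d ^ 2 / r ^ 2)
    by (unfold sonic_excess, zlim2; rewrite HB; field; lra).
  assert (H1 : 0 < (gamma d + 1) / 2 * K d r * (zup d r ^ 2 - 1)).
  { apply Rmult_lt_0_compat; [apply Rmult_lt_0_compat; lra | nra]. }
  assert (H2 : 0 <= kappa2 d ^ 2 / r ^ 2).
  { apply Rmult_le_pos; [nra |]. left. apply Rinv_0_lt_compat. nra. }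
  unfold supersonic. lra.
Qed.

Lemma supersonic_pattern (d : inflow) (pex rb : R) :
  admissible_inflow d -> 0 < K d (r0 d) -> shock_at d pex rb ->
  shock_margin d rb (zup d rb) < 0 ->
  supersonic_supersonic_shock d rb (upflow d) (downflow d rb) /\
  uniformly_supersonic d rb (downflow d rb).
Proof.
  intros Hd HK S Hm.
  destruct (down_excess_at_shock d pex rb Hd HK S) as [HKb Eb].
  assert (Hb : 0 < down_excess d rb rb) by (rewrite Eb; nra).
  assert (U : uniformly_supersonic d rb (downflow d rb)).
  { intros r Hr. pose proof (downflow_excess d pex rb r Hd HK S Hr) as E.
    assert (down_excess d rb rb <= down_excess d rb r).
    { destruct (proj2 Hr) as [Hlt | ->]; [| lra].
      left. now apply (down_excess_decreasing d pex). }
    unfold supersonic. lra. }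
  split; [split |]; [| apply U | exact U].
  - intros r Hr. now apply (upflow_supersonic d pex rb).
  - destruct S as (Hrb & _). lra.
Qed.

Lemma sonic_pattern (d : inflow) (pex rb : R) :
  admissible_inflow d -> 0 < K d (r0 d) -> shock_at d pex rb ->
  shock_margin d rb (zup d rb) = 0 ->
  supersonic_sonic_shock d rb (upflow d) (downflow d rb) /\
  supersonic_sonic_at_shock d rb (downflow d rb).
Proof.
  intros Hd HK S Hm.
  destruct (down_excess_at_shock d pex rb Hd HK S) as [HKb Eb].
  rewrite Hm, Rmult_0_r in Eb.
  assert (Hrb : r0 d < rb < r1 d) by apply S.
  assert (Sb : sonic (gamma d) (downflow d rb) rb).
  { pose proof (downflow_excess d pex rb rb Hd HK S). unfold sonic. lra. }
  split; split; try exact Sb.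
  - intros r Hr. now apply (upflow_supersonic d pex rb).
  - intros r Hr.
    pose proof (downflow_excess d pex rb r Hd HK S) as E.
    pose proof (down_excess_decreasing d pex rb r rb Hd HK S).
    unfold supersonic. lra.
Qed.

Lemma subsonic_pattern (d : inflow) (pex rb : R) :
  admissible_inflow d -> 0 < K d (r0 d) -> shock_at d pex rb ->
  0 < shock_margin d rb (zup d rb) ->
  subsonic_shock_patterns d pex rb (upflow d) (downflow d rb).
Proof.
  intros Hd HK S Hm.
  destruct (down_excess_at_shock d pex rb Hd HK S) as [HKb Eb].
  assert (Hb : down_excess d rb rb < 0) by (rewrite Eb; nra).
  assert (Hrb : r0 d < rb < r1 d) by apply S.
  pose proof (downflow_excess d pex rb) as E.
  pose proof (down_excess_decreasing d pex rb) as Dec.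
  assert (Shock : supersonic_subsonic_shock d rb (upflow d) (downflow d rb)).
  { split.
    - intros r Hr. now apply (upflow_supersonic d pex rb).
    - specialize (E rb Hd HK S). unfold subsonic. lra. }
  destruct (f2_sharp_sign d pex rb Hd HK S) as [m [Hm0 Ef]].
  split; [| split]; intros Hf; (split; [exact Shock |]); rewrite Ef in Hf.
  - assert (He : down_excess d rb (r0 d) < 0) by nra.
    intros r Hr. specialize (E r Hd HK S Hr).
    assert (down_excess d rb r <= down_excess d rb (r0 d)).
    { destruct (proj1 Hr) as [Hlt | <-]; [| lra]. left. apply Dec; lra || assumption. }
    unfold subsonic. lra.
  - assert (He : 0 < down_excess d rb (r0 d)) by nra.
    destruct (crossing_down (down_excess d rb) (r0 d) rb 0) as [rs [Hrs Ers]];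
      [lra | now apply down_excess_continuous | lra |].
    exists rs. split; [exact Hrs |]. split; [| split].
    + intros r Hr. specialize (E r Hd HK S).
      pose proof (Dec rs r Hd HK S). unfold subsonic. lra.
    + specialize (E rs Hd HK S). unfold sonic. lra.
    + intros r Hr. specialize (E r Hd HK S).
      pose proof (Dec r rs Hd HK S). unfold supersonic. lra.
  - assert (He : down_excess d rb (r0 d) = 0) by nra.
    split.
    + intros r Hr. specialize (E r Hd HK S).
      pose proof (Dec (r0 d) r Hd HK S). unfold subsonic. lra.
    + specialize (E (r0 d) Hd HK S). unfold sonic. lra.
Qed.

(** Since [shock_margin] increases with the radius, r'_* separates the three
    kinds of shock. *)
Lemma margin_sign (d : inflow) (pex rb rs : R) :
  admissible_inflow d -> 0 < K d (r0 d) -> shock_at d pex rb -> is_r_star' d rs ->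
  (rs < rb -> 0 < shock_margin d rb (zup d rb)) /\
  (rb < rs -> shock_margin d rb (zup d rb) < 0) /\
  (rb = rs -> shock_margin d rb (zup d rb) = 0).
Proof.
  intros Hd HK (Hrb & Hup & _) Hs. assert (H0 : 0 < r0 d) by apply Hd.
  destruct (r_star'_margin d rs Hd HK Hs) as (R1 & R2 & R3 & R4).
  assert (HKb : 0 < K d rb) by (apply (K_positive d (r0 d)); lra || assumption).
  split; [| split]; intros Hlt.
  - rewrite <- R4. now apply shock_margin_increasing.
  - rewrite <- R4. apply shock_margin_increasing; lra || assumption.
  - now subst rb.
Qed.

(** * The shock position as a function of the exit pressure *)

(** A pressure close to an end of the window lies beyond the pressures that
    separate any given circle, so the shock leaves every compact part of the
    annulus. *)
Lemma separating_limits (d : inflow) (p1 p0 : R) (rb : R -> R) :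
  r0 d < r1 d ->
  (forall pex, solvable_pressure d p1 p0 pex -> shock_at d pex (rb pex)) ->
  (forall r, r0 d < r < r1 d -> exists ps, p1 < ps < p0 /\ separates d r ps) ->
  filterlim rb (within (solvable_pressure d p1 p0) (locally p1)) (locally (r1 d)) /\
  filterlim rb (within (solvable_pressure d p1 p0) (locally p0)) (locally (r0 d)).
Proof.
  intros H01 Hrb Hsep.
  split; apply filterlim_locally; intros eps; pose proof (cond_pos eps) as Heps.
  - set (r := Rmax ((r0 d + r1 d) / 2) (r1 d - eps / 2)).
    assert (Hr : r0 d < r < r1 d /\ r1 d - eps / 2 <= r).
    { split; [| apply Rmax_r]. unfold r, Rmax. destruct Rle_dec; lra. }
    destruct (Hsep r (proj1 Hr)) as (ps & Hps & Hs).
    unfold within. eapply filter_imp; [| exact (open_lt ps p1 (proj1 Hps))].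
    intros pex Hlt HS. specialize (Hrb pex HS).
    destruct (Hs pex (rb pex) Hrb) as (H1 & _). specialize (H1 Hlt).
    destruct Hrb as (Hpos & _). apply Rabs_def1; unfold minus, plus, opp; simpl; lra.
  - set (r := Rmin ((r0 d + r1 d) / 2) (r0 d + eps / 2)).
    assert (Hr : r0 d < r < r1 d /\ r <= r0 d + eps / 2).
    { split; [| apply Rmin_r]. unfold r, Rmin. destruct Rle_dec; lra. }
    destruct (Hsep r (proj1 Hr)) as (ps & Hps & Hs).
    unfold within. eapply filter_imp; [| exact (open_gt ps p0 (proj2 Hps))].
    intros pex Hlt HS. specialize (Hrb pex HS).
    destruct (Hs pex (rb pex) Hrb) as (_ & H1 & _). specialize (H1 Hlt).
    destruct Hrb as (Hpos & _). apply Rabs_def1; unfold minus, plus, opp; simpl; lra.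
Qed.

Theorem theorem3p9 (d : inflow) (hd : admissible_inflow d) (hK : 0 < K d (r0 d)) :
  exists p1 p0 : R, 0 < p1 /\ p1 < p0 /\
    (forall pex : R, 0 < pex ->
       (0 < f2 d pex (rho_sharpsharp d pex) \/
        (f2 d pex (rho_sharpsharp d pex) <= 0 /\ ~ (p1 < pex < p0))) ->
       ~ (exists (rb : R) (Fm Fp : flow), problem_IV d pex rb Fm Fp)) /\
    exists (rb : R -> R) (Fm Fp : R -> flow),
      (forall pex : R, solvable_pressure d p1 p0 pex ->
         problem_IV d pex (rb pex) (Fm pex) (Fp pex) /\
         (forall (rb' : R) (Fm' Fp' : flow), problem_IV d pex rb' Fm' Fp' ->
            rb' = rb pex /\
            flow_agree (fun r => rb pex <= r <= r1 d) Fm' (Fm pex) /\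
            flow_agree (fun r => r0 d <= r <= rb pex) Fp' (Fp pex))) /\
      ((forall pex pex' : R,
          solvable_pressure d p1 p0 pex -> solvable_pressure d p1 p0 pex' ->
          pex < pex' -> rb pex' < rb pex) /\
       filterlim rb (within (solvable_pressure d p1 p0) (locally p1))
         (locally (r1 d)) /\
       filterlim rb (within (solvable_pressure d p1 p0) (locally p0))
         (locally (r0 d))) /\
      (forall rs' : R, is_r_star' d rs' ->
         (rs' <= r0 d ->
            forall pex : R, solvable_pressure d p1 p0 pex ->
              subsonic_shock_patterns d pex (rb pex) (Fm pex) (Fp pex)) /\
         (r0 d < rs' < r1 d ->
            exists ps' : R, p1 < ps' < p0 /\
              forall pex : R, solvable_pressure d p1 p0 pex ->
                (pex < ps' ->
                   subsonic_shock_patterns d pex (rb pex) (Fm pex) (Fp pex)) /\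
                (ps' < pex ->
                   supersonic_supersonic_shock d (rb pex) (Fm pex) (Fp pex) /\
                   uniformly_supersonic d (rb pex) (Fp pex)) /\
                (pex = ps' ->
                   supersonic_sonic_shock d (rb pex) (Fm pex) (Fp pex) /\
                   supersonic_sonic_at_shock d (rb pex) (Fp pex))) /\
         (r1 d <= rs' ->
            forall pex : R, solvable_pressure d p1 p0 pex ->
              supersonic_supersonic_shock d (rb pex) (Fm pex) (Fp pex) /\
              uniformly_supersonic d (rb pex) (Fp pex))).
Proof.
  destruct (pressure_window d hd hK) as (p1 & p0 & Hp1 & Hp10 & Hsolv & Hsep).
  set (rb := fun pex => epsilon (inhabits 0) (fun r => shock_at d pex r)).
  assert (Hrb : forall pex, solvable_pressure d p1 p0 pex -> shock_at d pex (rb pex)).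
  { intros pex H. apply (epsilon_spec (inhabits 0) (fun r => shock_at d pex r)).
    now apply Hsolv. }
  assert (H01 : r0 d < r1 d) by apply hd.
  exists p1, p0. split; [exact Hp1 |]. split; [exact Hp10 |]. split.
  { intros pex Hpex Hno (rb' & Fm & Fp & HIV).
    destruct (shock_at_of_problem_IV d pex rb' Fm Fp hd hK HIV) as (S & _).
    destruct (proj2 (Hsolv pex) (ex_intro _ rb' S)) as (_ & Hf & Hw).
    destruct Hno as [Hf' | [_ Hw']]; [lra | exact (Hw' Hw)]. }
  exists rb, (fun _ => upflow d), (fun pex => downflow d (rb pex)).
  split; [| split].
  - intros pex HS. specialize (Hrb pex HS).
    split; [now apply problem_IV_of_shock_at |].
    intros rb' Fm' Fp' HIV.
    destruct (shock_at_of_problem_IV d pex rb' Fm' Fp' hd hK HIV) as (S & A1 & A2).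
    assert (E : rb' = rb pex)
      by exact (proj2 (shock_at_compare d pex pex rb' (rb pex) hd hK S Hrb) eq_refl).
    rewrite E in A1, A2. now split.
  - split; [| now apply separating_limits].
    intros pex pex' HS HS' Hlt.
    exact (proj1 (shock_at_compare d pex pex' _ _ hd hK (Hrb pex HS) (Hrb pex' HS')) Hlt).
  - intros rs Hrs.
    pose proof (fun pex HS => margin_sign d pex (rb pex) rs hd hK (Hrb pex HS) Hrs) as M.
    split; [| split].
    + intros Hle pex HS. pose proof (proj1 (Hrb pex HS)).
      apply subsonic_pattern; try assumption; [now apply Hrb |].
      apply (M pex HS). lra.
    + intros Hin. destruct (Hsep rs Hin) as (ps & Hps & Hs).
      exists ps. split; [exact Hps |]. intros pex HS.
      specialize (M pex HS). specialize (Hrb pex HS).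
      destruct (Hs pex (rb pex) Hrb) as (S1 & S2 & S3).
      destruct M as (M1 & M2 & M3).
      split; [| split]; intros Hp.
      * apply subsonic_pattern; try assumption. now apply M1, S1.
      * apply (supersonic_pattern d pex); try assumption. now apply M2, S2.
      * apply (sonic_pattern d pex); try assumption. now apply M3, S3.
    + intros Hge pex HS. pose proof (proj1 (Hrb pex HS)).
      apply (supersonic_pattern d pex); try assumption; [now apply Hrb |].
      apply (M pex HS). lra.
Qed.
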